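(* Let $n\geq 1$, let $q\in\mathbb{C}$ be a fixed non-zero element, and for $k=1,2,\dots$ let $t_k=\mathrm{Tr}({}_qX^k)\in\mathcal{O}(M_q)$ be the trace of the $k$-th quantum power of the generic $n\times n$ quantum matrix $X=(x_{ij})$. Then $[t_k,t_m]=t_kt_m-t_mt_k=0$ for all $k,m=1,2,\dots$. Moreover, the elements $t_{n+1},t_{n+2},\dots$ can be expressed as polynomials (with complex coefficients) of $t_1,\dots,t_n$.
   Context: For integers $i,j$ put $\theta(i,j)=1$ if $i<j$, $\theta(i,j)=0$ if $i=j$, and $\theta(i,j)=-1$ if $i>j$. The coordinate ring $\mathcal{O}(M_q)$ of $n\times n$ quantum matrices is the (unital, associative) $\mathbb{C}$-algebra generated by $x_{ij}$, $1\leq i,j\leq n$, subject to the relations $$x_{ij}x_{kl}-x_{kl}x_{ij}=(q^{\theta(j,l)}-q^{-\theta(i,k)})x_{il}x_{kj},\qquad 1\leq i,j,k,l\leq n,$$ where $q$ is a fixed non-zero element of $\mathbb{C}$. Let $X$ be the $n\times n$ matrix with $(i,j)$ entry $x_{ij}$. For $n\times n$ matrices $A=(a_{ij})$, $B=(b_{ij})$ with entries from $\mathcal{O}(M_q)$, the $q$-multiplication $A\star B$ is the $n\times n$ matrix with $(i,j)$ entry $$(A\star B)_{ij}=\sum_{k=1}^n q^{\theta(j,k)}a_{ik}b_{kj}.$$ (This multiplication is not associative.) The quantum powers of $X$ are defined recursively by ${}_qX^0=I$ (the identity matrix), ${}_qX^1=X$, and ${}_qX^k=X\star({}_qX^{k-1})$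 for $k\geq 2$. $\mathrm{Tr}$ denotes the usual trace (the sum of the diagonal entries) of a matrix. *)

(* Defs.v *)
From HB Require Import structures.
From mathcomp Require Import all_boot all_order all_algebra.
From mathcomp Require Import generic_quotient ring_quotient.
From mathcomp Require Import boolp.
From mathcomp Require Import monalg.

Set Implicit Arguments.
Unset Strict Implicit.
Unset Printing Implicit Defensive.

Import GRing.Theory.
Local Open Scope ring_scope.
Local Open Scope quotient_scope.

(* Closure under opposite follows from absorption of multiplication by -1. *)
Inductive ideal_gen (A : nzRingType) (S : A -> Prop) : A -> Prop :=
| ideal_gen_mem a of S a : ideal_gen S a
| ideal_gen0 : ideal_gen S 0
| ideal_genD a b of ideal_gen S a & ideal_gen S b : ideal_gen S (a + b)
| ideal_genMl a b of ideal_gen S b : ideal_gen S (a * b)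
| ideal_genMr a b of ideal_gen S a : ideal_gen S (a * b).

(* Quotient of an algebra by a two-sided ideal.  ring_quotient only puts a ring
   structure on quotients of commutative rings. *)
Section AlgebraQuotient.
Context (C : fieldType) (A : algType C) (S : A -> Prop).

Definition idealb : {pred A} := fun a => `[< ideal_gen S a >].

Lemma idealbP a : reflect (ideal_gen S a) (a \in idealb).
Proof. exact: asboolP. Qed.

Lemma idealbMl a b : b \in idealb -> a * b \in idealb.
Proof. by move=> /idealbP bI; apply/idealbP; apply: ideal_genMl. Qed.

Lemma idealbMr a b : a \in idealb -> a * b \in idealb.
Proof. by move=> /idealbP aI; apply/idealbP; apply: ideal_genMr. Qed.

Fact idealb_zmod_closed : zmod_closed idealb.
Proof.
split; first by apply/idealbP; apply: ideal_gen0.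
move=> a b /idealbP aI /idealbP bI; apply/idealbP; apply: ideal_genD => //.
by rewrite -mulN1r; apply: ideal_genMl.
Qed.
HB.instance Definition _ := GRing.isZmodClosed.Build A idealb idealb_zmod_closed.

(* The properness argument is only there to make the quotient nontrivial, as
   required by nzRingType. *)
Definition algquot (S1 : ~ ideal_gen S 1) : Type := {ideal_quot idealb}.

Context (S1 : ~ ideal_gen S 1).
Local Notation Q := (algquot S1).

HB.instance Definition _ := GRing.Zmodule.on Q.
HB.instance Definition _ := EqQuotient.on Q.

Definition algpi (a : A) : Q := \pi_Q a.
Definition algquot_one : Q := algpi 1.
Definition algquot_mul (x y : Q) : Q := algpi (repr x * repr y).
Definition algquot_scale (c : C) (x : Q) : Q := algpi (c *: repr x).

Lemma algpi_eqP a b : reflect (algpi a = algpi b) (a - b \in idealb).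
Proof. by rewrite Quotient.idealrBE; apply: eqP. Qed.

Lemma algpiK x : algpi (repr x) = x.
Proof. exact: reprK. Qed.

Lemma algpi_reprB a : a - repr (algpi a) \in idealb.
Proof. by apply/algpi_eqP; rewrite algpiK. Qed.

Fact algpiD : {morph algpi : a b / a + b}.
Proof. exact: Quotient.pi_add. Qed.

Fact algpi0 : algpi 0 = 0.
Proof. by apply: (addrI (algpi 0)); rewrite -algpiD !addr0. Qed.

Lemma algpiMdef a b : algpi (a * b) = algquot_mul (algpi a) (algpi b).
Proof.
apply/algpi_eqP; set a' := repr _; set b' := repr _.
have -> : a * b - a' * b' = a * (b - b') + (a - a') * b'.
  by rewrite mulrBr mulrBl addrA subrK.
by apply: rpredD; [apply/idealbMl/algpi_reprB | apply/idealbMr/algpi_reprB].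
Qed.

Lemma algpiZdef c a : algpi (c *: a) = algquot_scale c (algpi a).
Proof.
apply/algpi_eqP; rewrite -scalerBr -[_ - _]mul1r scalerAl.
exact/idealbMl/algpi_reprB.
Qed.

Fact algquot_mulA : associative algquot_mul.
Proof.
move=> x y z; rewrite -[x]algpiK -[y]algpiK -[z]algpiK.
by rewrite -!algpiMdef mulrA.
Qed.

Fact algquot_mul1 : left_id algquot_one algquot_mul.
Proof. by move=> x; rewrite -[x]algpiK -algpiMdef mul1r. Qed.

Fact algquot_mulr1 : right_id algquot_one algquot_mul.
Proof. by move=> x; rewrite -[x]algpiK -algpiMdef mulr1. Qed.

Fact algquot_mulDl : left_distributive algquot_mul +%R.
Proof.
move=> x y z; rewrite -[x]algpiK -[y]algpiK -[z]algpiK.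
by rewrite -algpiD -!algpiMdef -algpiD mulrDl.
Qed.

Fact algquot_mulDr : right_distributive algquot_mul +%R.
Proof.
move=> x y z; rewrite -[x]algpiK -[y]algpiK -[z]algpiK.
by rewrite -algpiD -!algpiMdef -algpiD mulrDr.
Qed.

Fact algquot_one_neq0 : algquot_one != 0.
Proof.
rewrite -algpi0; apply/eqP => /algpi_eqP; rewrite subr0.
by move/idealbP/S1.
Qed.

HB.instance Definition _ := GRing.Zmodule_isNzRing.Build Q
  algquot_mulA algquot_mul1 algquot_mulr1 algquot_mulDl algquot_mulDr
  algquot_one_neq0.

Fact algquot_scaleA c d x :
  algquot_scale c (algquot_scale d x) = algquot_scale (c * d) x.
Proof. by rewrite -[x]algpiK -!algpiZdef scalerA. Qed.

Fact algquot_scale1 : left_id 1 algquot_scale.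
Proof. by move=> x; rewrite -[x]algpiK -algpiZdef scale1r. Qed.

Fact algquot_scaleDr : right_distributive algquot_scale +%R.
Proof.
move=> c x y; rewrite -[x]algpiK -[y]algpiK.
by rewrite -algpiD -!algpiZdef -algpiD scalerDr.
Qed.

Fact algquot_scaleDl x : {morph algquot_scale^~ x : c d / c + d}.
Proof.
by move=> c d; rewrite -[x]algpiK -!algpiZdef -algpiD scalerDl.
Qed.

HB.instance Definition _ := GRing.Zmodule_isLmodule.Build C Q
  algquot_scaleA algquot_scale1 algquot_scaleDr algquot_scaleDl.

Fact algpiM : {morph algpi : a b / a * b}.
Proof. exact: algpiMdef. Qed.

Fact algpiZ c : {morph algpi : a / c *: a}.
Proof. exact: algpiZdef. Qed.

Fact algquot_scaleAl (c : C) (x y : Q) : c *: (x * y) = c *: x * y.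
Proof.
rewrite -[x]algpiK -[y]algpiK -algpiM -!algpiZ -algpiM.
by rewrite scalerAl.
Qed.
HB.instance Definition _ := GRing.Lmodule_isLalgebra.Build C Q algquot_scaleAl.

Fact algquot_scaleAr (c : C) (x y : Q) : c *: (x * y) = x * (c *: y).
Proof.
rewrite -[x]algpiK -[y]algpiK -algpiM -!algpiZ -algpiM.
by rewrite scalerAr.
Qed.
HB.instance Definition _ := GRing.Lalgebra_isAlgebra.Build C Q algquot_scaleAr.

Fact algpi_is_zmod_morphism : zmod_morphism algpi.
Proof.
move=> a b; apply: (addIr (algpi b)).
by rewrite -algpiD !subrK.
Qed.
HB.instance Definition _ :=
  GRing.isZmodMorphism.Build A Q algpi algpi_is_zmod_morphism.
HB.instance Definition _ :=
  GRing.isMonoidMorphism.Build A Q algpi (erefl, algpiM).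
HB.instance Definition _ :=
  GRing.isScalable.Build C A Q *:%R algpi algpiZ.

Lemma algpiB : {morph algpi : a b / a - b}.
Proof. exact: raddfB. Qed.

End AlgebraQuotient.

(* Free associative algebra on the letters (i, j): the monoid algebra of the
   free monoid of words. *)
Definition freealg (C : fieldType) (n : nat) : Type :=
  {malg C[{fmonom ('I_n * 'I_n)%type}]}.
HB.instance Definition _ (C : fieldType) (n : nat) :=
  GRing.Lalgebra.on (freealg C n).

Fact freealg_scaleAr (C : fieldType) n (c : C) (f g : freealg C n) :
  c *: (f * g) = f * (c *: g).
Proof.
pose F := {malg C[{fmonom ('I_n * 'I_n)%type}]}.
have comm (h : F) : malgC c * h = h * malgC c.
  rewrite /malgC !malgM_def fgmulUg fgmulgU.
  by apply: eq_bigr => m _; rewrite mul1m mulm1 mulrC.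
suff: forall u v : F, c *: (u * v) = u * (c *: v) by apply.
by move=> u v; rewrite -!mul_malgC mulrA comm mulrA.
Qed.
HB.instance Definition _ (C : fieldType) (n : nat) :=
  GRing.Lalgebra_isAlgebra.Build C (freealg C n) (@freealg_scaleAr C n).

Definition theta (i j : int) : int :=
  if i < j then 1 else if i == j then 0 else -1.

Section QuantumMatrices.
Context (C : fieldType) (n : nat) (q : C).

Definition fgen (i j : 'I_n) : freealg C n := mkmalgU (fmu (i, j)) 1.

Definition qrelator (f : freealg C n) : Prop :=
  exists i j k l : 'I_n,
    f = fgen i j * fgen k l - fgen k l * fgen i j
        - (q ^ theta j l - q ^ (- theta i k)) *: (fgen i l * fgen k j).

Fact qrelator_proper : ~ ideal_gen qrelator 1.
Proof.
pose F := {malg C[{fmonom ('I_n * 'I_n)%type}]}.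
pose ev : F -> C := mcoeff (@mone _).
have g0 i j : ev (fgen i j) = 0 by rewrite /ev mcoeffU fm1_eq1.
have M (u v : F) : ev (u * v) = ev u * ev v by exact: rmorphM.
have rel0 (x : C) (u v w z u' v' : F) : ev u = 0 -> ev w = 0 -> ev u' = 0 ->
    ev (u * v - w * z - x *: (u' * v')) = 0.
  move=> u0 w0 u'0; rewrite /ev !mcoeffB mcoeffZ -/ev.
  by rewrite !M u0 w0 u'0 !mul0r mulr0 !subr0.
have H (f : freealg C n) : ideal_gen qrelator f -> ev f = 0.
  elim=> {f} [f [i [j [k [l ->]]]]||u v _ u0 _ v0|u v _ v0|u v _ u0].
  - exact: rel0.
  - exact: mcoeff0.
  - by rewrite [LHS]mcoeffD -/(ev u) -/(ev v) u0 v0 addr0.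
  - by rewrite [LHS]M v0 mulr0.
  - by rewrite [LHS]M u0 mul0r.
by move/H/eqP; rewrite [ev _](rmorph1 (mcoeff (@mone _) : F -> C)) oner_eq0.
Qed.

(* The coordinate ring of n x n quantum matrices, O(M_q). *)
Definition qmat : Type := algquot qrelator_proper.
HB.instance Definition _ := GRing.Algebra.on qmat.

Definition qgen : 'M[qmat]_n := \matrix_(i, j) algpi qrelator_proper (fgen i j).

Lemma qgen_rel (i j k l : 'I_n) :
  qgen i j * qgen k l - qgen k l * qgen i j =
  (q ^ theta j l - q ^ (- theta i k)) *: (qgen i l * qgen k j).
Proof.
rewrite !mxE -!algpiM -algpiB -algpiZ.
by apply/algpi_eqP/idealbP/ideal_gen_mem; exists i, j, k, l.
Qed.

Definition qmulmx (A B : 'M[qmat]_n) : 'M[qmat]_n :=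
  \matrix_(i, j) \sum_(k < n) q ^ theta j k *: (A i k * B k j).

Fixpoint qexpmx (A : 'M[qmat]_n) (k : nat) : 'M[qmat]_n :=
  match k with
  | 0 => 1%:M
  | 1 => A
  | k'.+1 => qmulmx A (qexpmx A k')
  end.

Definition qtrace (k : nat) : qmat := \tr (qexpmx qgen k).

End QuantumMatrices.

(* Main.v *)
(** Put [sigma_k] for the sum of the principal quantum [k x k] minors.

    Newton: let [h_m(i,j)] be the sum over the [m]-subsets [I] not containing [j]
    of the quantum minors with rows [i, I] and columns [j, I], suitably
    normalised.  Expanding along row [i], the powers of [- q] combine into the
    factors [q ^ theta j k] of the star product, so that
    [h_(m+1) = X sigma_(m+1) - X * h_m] entrywise, and [h_m] has trace
    [(m+1) sigma_(m+1)].  Hence the [t_k] and the [sigma_k] satisfy the classical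
    Newton identities, without quantum integers, for every nonzero [q].

    Commutation: it remains to see that the [sigma_k] commute.  They are the
    characters of the quantum exterior powers, and the braiding of the exterior
    algebra with itself intertwines [Lambda^a (x) Lambda^b] with
    [Lambda^b (x) Lambda^a].  Its matrix is triangular with a diagonal of powers
    of [q], hence invertible for every nonzero [q], roots of unity included, so
    the two tensor products have the same character. *)
Require Import Defs.
From HB Require Import structures.
From mathcomp Require Import all_boot all_order all_algebra.
From mathcomp Require Import reals complex.
From mathcomp Require mpoly.
Import (canonicals) mpoly.
From mathcomp Require Import ring.

Set Implicit Arguments.
Unset Strict Implicit.
Unset Printing Implicit Defensive.

Import GRing.Theory.
Local Open Scope ring_scope.

(** * Linear combinations in modules *)

(* [ring] and [field] do not apply to modules: [lmod_eq] reduces an equality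
   between linear combinations to the equalities between the coefficients. *)
Inductive lexp (C : Type) : Type :=
| LVar of nat
| LZero
| LAdd of lexp C & lexp C
| LScale of C & lexp C.
Arguments LVar {C}.
Arguments LZero {C}.

Section Lexp.
Context (C : pzRingType) (U : lmodType C).

Fixpoint leval (env : seq U) (e : lexp C) : U :=
  match e with
  | LVar k => nth 0 env k
  | LZero => 0
  | LAdd e1 e2 => leval env e1 + leval env e2
  | LScale c e1 => c *: leval env e1
  end.

Fixpoint lcoef (k : nat) (e : lexp C) : C :=
  match e with
  | LVar j => if eqn j k then 1 else 0
  | LZero => 0
  | LAdd e1 e2 => lcoef k e1 + lcoef k e2
  | LScale c e1 => c * lcoef k e1
  end.

Lemma leval_sum env e :
  leval env e = \sum_(k < size env) lcoef k e *: env`_k.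
Proof.
elim: e => [j||e1 IH1 e2 IH2|c e IHe] /=.
- have [lt_j|le_j] := ltnP j (size env); last first.
    rewrite nth_default // big1 // => k _.
    by rewrite eqnE gtn_eqF ?scale0r // (leq_trans _ le_j).
  rewrite (bigD1 (Ordinal lt_j)) //= eqnE eqxx scale1r big1 ?addr0 // => k.
  by rewrite -val_eqE /= eq_sym => /negPf->; rewrite scale0r.
- by rewrite big1 // => k _; rewrite scale0r.
- by rewrite IH1 IH2 -big_split; apply: eq_bigr => k _; rewrite scalerDl.
by rewrite IHe scaler_sumr; apply: eq_bigr => k _; rewrite scalerA.
Qed.

(** The hypothesis computes to a conjunction with one coefficient equation per atom of [env], so
    splitting it leaves goals for [ring] or [field]. *)
Lemma leval_eq env e1 e2 :
  foldr (fun k P => lcoef k e1 = lcoef k e2 /\ P) True (iota 0 (size env)) ->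
  leval env e1 = leval env e2.
Proof.
have gen m j i : foldr (fun k P => lcoef k e1 = lcoef k e2 /\ P) True (iota j m) ->
    (i < m)%N -> lcoef (j + i) e1 = lcoef (j + i) e2.
  elim: m j i => // m IHm j [|i] /= [Ej H]; rewrite ?addn0 // ltnS addnS -addSn.
  exact: IHm.
move=> H; rewrite !leval_sum; apply: eq_bigr => k _.
by congr (_ *: _); exact: (gen _ _ _ H (ltn_ord k)).
Qed.

End Lexp.

Ltac lmod_index x env :=
  lazymatch env with
  | x :: _ => constr:(O)
  | _ :: ?env' => let k := lmod_index x env' in constr:(S k)
  end.

Ltac lmod_mem x env :=
  lazymatch env with
  | x :: _ => constr:(true)
  | _ :: ?env' => lmod_mem x env'
  | _ => constr:(false)
  end.

Ltac lmod_atoms env t :=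
  lazymatch t with
  | 0 => env
  | ?a + ?b => let env1 := lmod_atoms env a in lmod_atoms env1 b
  | _ *: ?a => lmod_atoms env a
  | _ => lazymatch lmod_mem t env with
         | true => env
         | false => constr:(t :: env)
         end
  end.

Ltac lmod_reify C env t :=
  lazymatch t with
  | 0 => constr:(@LZero C)
  | ?a + ?b => let ea := lmod_reify C env a in let eb := lmod_reify C env b in
               constr:(LAdd ea eb)
  | ?c *: ?a => let ea := lmod_reify C env a in constr:(@LScale C c ea)
  | _ => let k := lmod_index t env in constr:(@LVar C k)
  end.

Ltac lmod_eq C :=
  lazymatch goal with
  | |- ?l = ?r =>
    let U := type of l in
    let env0 := constr:(@nil U) in
    let env1 := lmod_atoms env0 l in
    let env := lmod_atoms env1 r in
    let el := lmod_reify C env l in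
    let er := lmod_reify C env r in
    apply: (@leval_eq _ _ env el er); cbn [foldr iota size lcoef eqn];
    repeat split
  end.

(** * Quantum exterior algebra and Fock spaces *)

Definition below n (a : 'I_n) (J : {set 'I_n}) : nat :=
  #|[set b in J | (b < a)%N]|.

(** Both sides are strictly increasing lists with the same members, and such a list is determined by
    its members. *)
Lemma enum_set_split n (a : 'I_n) (J : {set 'I_n}) :
  enum J = enum [set b in J | (b < a)%N] ++ nseq (a \in J) a
           ++ enum [set b in J | (a < b)%N].
Proof.
have srt (B : {set 'I_n}) : sorted (fun i j : 'I_n => (i < j)%N) (enum B).
  rewrite {1}/enum_mem; apply: sorted_filter; first by move=> ???; apply: ltn_trans.
  by rewrite -enumT -(@sorted_map _ _ val ltn) val_enum_ord iota_ltn_sorted.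
have tr : transitive (fun i j : 'I_n => (i < j)%N) by move=> ???; apply: ltn_trans.
apply: (irr_sorted_eq tr) => //; first by move=> i; apply: ltnn.
  rewrite sorted_pairwise // pairwise_cat pairwise_cat -!sorted_pairwise // !srt.
  rewrite ?andbT /=; apply/and3P; split.
  - apply/allrelP => x y; rewrite mem_cat !mem_enum !inE => /andP[_ xa].
    case/orP=> [|/andP[_]]; last exact: ltn_trans.
    by rewrite mem_nseq => /andP[_ /eqP->].
  - apply/allrelP => x y; rewrite mem_enum !inE mem_nseq.
    by case/andP=> _ /eqP-> /andP[].
  - by case: (_ \in _).
move=> b; rewrite !mem_cat !mem_enum !inE mem_nseq.
have [ba|ab|/val_inj->] := ltngtP b a; rewrite ?andbT ?andbF ?orbF ?orbT //=.
- by rewrite -val_eqE ltn_eqF ?andbF ?orbF.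
- by rewrite -val_eqE gtn_eqF ?andbF.
by rewrite eqxx; case: (a \in J).
Qed.

Section Exterior.
Context (C : fieldType) (n : nat) (q : C) (q_neq0 : q != 0).
Implicit Types (i j k a b : 'I_n) (I J K : {set 'I_n}) (s u : seq 'I_n).

(* [F] factors through the quantum exterior algebra: [F s] depends only on the
   product of the generators listed in [s]. *)
Definition ext_seq (U : lmodType C) (F : seq 'I_n -> U) : Prop :=
  forall u s a, F (u ++ a :: a :: s) = 0 /\
    forall b, (a < b)%N -> F (u ++ b :: a :: s) = - q *: F (u ++ a :: b :: s).

(** Each smaller letter that [a] passes on its way to the right costs one factor [- q]. *)
Lemma ext_seq_move (U : lmodType C) (F : seq 'I_n -> U) u s r a : ext_seq F ->
  all (fun b => (b < a)%N) s ->
  F (u ++ a :: s ++ r) = (- q) ^+ size s *: F (u ++ s ++ a :: r).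
Proof.
move=> extF; elim: s u => [|b s IHs] u /=; first by rewrite scale1r.
case/andP=> ba sa; rewrite (extF u (s ++ r) b).2 //.
by rewrite -cat_rcons IHs // scalerA -exprS cat_rcons.
Qed.

(** The letter [a] moves to its place in the increasing word, past the [below a J] smaller letters;
    if it already occurs there, the two adjacent copies give zero. *)
Lemma ext_seq_cons (U : lmodType C) (F : seq 'I_n -> U) a J : ext_seq F ->
  F (a :: enum J) =
  if a \in J then 0 else (- q) ^+ below a J *: F (enum (a |: J)).
Proof.
move=> extF; rewrite (enum_set_split a J).
have lt : all (fun b : 'I_n => (b < a)%N) (enum [set b in J | (b < a)%N]).
  by apply/allP => b; rewrite mem_enum !inE => /andP[].
rewrite -[_ :: _]/([::] ++ _) (ext_seq_move _ _ extF lt) /=.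
case: ifP => aJ; first by rewrite (extF _ _ a).1 scaler0.
rewrite -cardE; congr (_ *: F _); rewrite (enum_set_split a (a |: J)) setU11 /=.
suff E (P : pred 'I_n) : ~~ P a -> [set b in a |: J | P b] = [set b in J | P b].
  by rewrite !E ?ltnn.
by move=> aP; apply/setP => b; rewrite !inE; case: eqP => [->|] //;
  rewrite (negPf aP) !andbF.
Qed.

(** Through such operators [U] is a left module over the quantum exterior algebra. *)
Definition ext_ops (U : lmodType C) (T : 'I_n -> {linear U -> U}) : Prop :=
  forall a v, T a (T a v) = 0 /\
    forall b, (a < b)%N -> T b (T a v) = - q *: T a (T b v).

Definition opseq (U : lmodType C) (T : 'I_n -> {linear U -> U}) s (v : U) : U :=
  foldr (fun a => T a) v s.

Fact opseq_is_linear (U : lmodType C) (T : 'I_n -> {linear U -> U}) s :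
  linear (opseq T s).
Proof. by move=> c v w; elim: s => //= a s ->; rewrite linearP. Qed.
HB.instance Definition _ (U : lmodType C) (T : 'I_n -> {linear U -> U}) s :=
  GRing.isLinear.Build C U U *:%R (opseq T s) (opseq_is_linear T s).

Lemma ext_ops_seq (U : lmodType C) (T : 'I_n -> {linear U -> U}) v :
  ext_ops T -> ext_seq (fun s => opseq T s v).
Proof.
move=> extT u s a; rewrite /opseq; split=> [|b ab]; rewrite !foldr_cat /=.
  by rewrite (extT _ _).1; elim: u => //= c u ->; rewrite linear0.
by rewrite (extT _ _).2 //; elim: u => //= c u ->; rewrite linearZ.
Qed.

Lemma ext_ops_cons (U : lmodType C) (T : 'I_n -> {linear U -> U}) v a J :
  ext_ops T -> T a (opseq T (enum J) v) =
  if a \in J then 0 else (- q) ^+ below a J *: opseq T (enum (a |: J)) v.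
Proof. by move=> extT; exact: (ext_seq_cons a J (ext_ops_seq v extT)). Qed.

(* [f : fock W] stands for the sum of the [xi_J (x) f J], where [xi_J] is the
   increasing product of the generators; [creat a] is left multiplication by
   [xi_a]. *)
Definition fock (W : lmodType C) := {ffun {set 'I_n} -> W}.
HB.instance Definition _ (W : lmodType C) := GRing.Lmodule.on (fock W).

Definition delta (W : lmodType C) J (w : W) : fock W :=
  [ffun K : {set 'I_n} => if K == J then w else 0].

Fact delta_is_linear (W : lmodType C) J : linear (@delta W J).
Proof.
by move=> c v w; apply/ffunP => K; rewrite !ffunE; case: eqP; rewrite // scaler0 addr0.
Qed.
HB.instance Definition _ (W : lmodType C) J :=
  GRing.isLinear.Build C W (fock W) *:%R (@delta W J) (@delta_is_linear W J).

Lemma fock_sum (W : lmodType C) (f : fock W) : f = \sum_K delta K (f K).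
Proof.
apply/ffunP => K; rewrite sum_ffunE (bigD1 K) //= big1 ?addr0 ?ffunE ?eqxx //.
by move=> J JK; rewrite ffunE eq_sym (negPf JK).
Qed.

Definition creat (W : lmodType C) a (f : fock W) : fock W :=
  [ffun J : {set 'I_n} => if a \in J then (- q) ^+ below a J *: f (J :\ a) else 0].

Fact creat_is_linear (W : lmodType C) a : linear (@creat W a).
Proof.
move=> c v w; apply/ffunP => K; rewrite !ffunE.
by case: ifP => _; rewrite ?scaler0 ?addr0 // !scalerDr !scalerA mulrC.
Qed.
HB.instance Definition _ (W : lmodType C) a :=
  GRing.isLinear.Build C (fock W) (fock W) *:%R (@creat W a) (@creat_is_linear W a).

Lemma creatZ (W : lmodType C) a c (f : fock W) : creat a (c *: f) = c *: creat a f.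
Proof. exact: linearZ. Qed.

Lemma creatD (W : lmodType C) a : {morph @creat W a : f h / f + h}.
Proof. exact: linearD. Qed.

Definition creats (W : lmodType C) a : {linear fock W -> fock W} := @creat W a.

Lemma belowD1 a b J : (b <= a)%N -> below b (J :\ a) = below b J.
Proof.
move=> ba; apply: eq_card => c; rewrite !inE.
by case: eqP => //= ->; rewrite ltnNge ba andbF.
Qed.

Lemma belowU1 a b J : (b <= a)%N -> below b (a |: J) = below b J.
Proof.
move=> ba; apply: eq_card => c; rewrite !inE.
by case: eqP => //= ->; rewrite ltnNge ba !andbF.
Qed.

Lemma belowU1_lt a b J : a \notin J -> (a < b)%N -> below b (a |: J) = (below b J).+1.
Proof.
move=> aJ ab; rewrite /below -[RHS]add1n -[1%N]/(nat_of_bool true).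
have <- : a \notin [set c in J | (c < b)%N] by rewrite !inE (negPf aJ).
rewrite -cardsU1; apply: eq_card => c; rewrite !inE.
by case: eqP => //= ->; rewrite ab.
Qed.

Lemma creat_ext (W : lmodType C) : ext_ops (@creats W).
Proof.
move=> a f; split=> [|b ab]; apply/ffunP => J; rewrite !ffunE.
  by rewrite !inE eqxx /=; case: ifP; rewrite ?scaler0.
rewrite !inE (_ : (a == b) = false); last by rewrite -val_eqE ltn_eqF.
rewrite eq_sym (_ : (a == b) = false) /=; last by rewrite -val_eqE ltn_eqF.
case: ifP => bJ; case: ifP => aJ; rewrite ?scaler0 //.
rewrite !scalerA setDDl setUC -setDDl -(belowD1 J (ltnW ab)).
have {1}-> : J = a |: (J :\ a) by rewrite setD1K.
by rewrite (belowU1_lt _ ab) ?setD11 // exprS !mulrA; congr (_ *: _); ring.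
Qed.

Lemma creat_delta (W : lmodType C) a J (w : W) :
  creat a (delta J w) =
  if a \in J then 0 else (- q) ^+ below a J *: delta (a |: J) w.
Proof.
apply/ffunP => K; rewrite ffunE; case: (boolP (a \in J)) => aJ; rewrite !ffunE.
  case: ifP => // aK; case: eqP aJ => [<-|_ _]; last exact: scaler0.
  by rewrite setD11.
case: (K =P a |: J) => [->|KJ].
  by rewrite setU11 setU1K // eqxx belowU1.
case: ifP => // aK; last by rewrite scaler0.
case: eqP => [E|_]; last by rewrite !scaler0.
by case: KJ; rewrite -E setD1K.
Qed.

(** Peel off the least element of [J]: creating it in front costs no power of [- q]. *)
Lemma creat_enum (W : lmodType C) J (w : W) :
  opseq (@creats W) (enum J) (delta set0 w) = delta J w.
Proof.
elim: {J}_.+1 {-2}J (ltnSn #|J|) => // m IH J Jm.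
have [->|[a0 a0J]] := set_0Vmem J; first by rewrite enum_set0.
case: (arg_minnP val a0J) => a aJ amin.
have below0 : below a J = 0%N.
  apply/eqP; rewrite cards_eq0; apply/eqP/setP => b; rewrite !inE.
  by apply/negP => /andP[/amin]; rewrite leqNgt => /negP.
have := ext_ops_cons (delta set0 w) a (J :\ a) (@creat_ext W).
rewrite setD11 setD1K // belowD1 // below0 scale1r => <-.
rewrite IH; last by move: Jm; rewrite (cardsD1 a J) (aJ : a \in J).
by rewrite [LHS]creat_delta setD11 belowD1 // below0 scale1r setD1K.
Qed.

End Exterior.

(** * Braiding with an exterior algebra *)

Section Braiding.
Context (C : fieldType) (n : nat) (q : C) (q_neq0 : q != 0).
Implicit Types (i j k a b : 'I_n) (I J K : {set 'I_n}) (s u : seq 'I_n).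

Local Notation g := (q - q^-1).

(* The commutation rule [eta_i xi_a = ...] between the generators of the two
   factors of a braided tensor square of the quantum exterior algebra. *)
Definition cross (U : lmodType C) (E X : 'I_n -> {linear U -> U}) : Prop :=
  forall i a v, E i (X a v) =
    q ^+ (i == a) *: X a (E i v) + (if (i < a)%N then g else 0) *: X i (E a v).

Section Hop.
Context (W : lmodType C) (Psi : 'I_n -> {linear W -> W}).

(* [hword s i w] is [eta_i xi_s (x) w] once [eta_i] has been moved past [xi_s] by
   [cross] and acts on [w] through [Psi i]. *)
Fixpoint hword s i (w : W) : fock n W :=
  match s with
  | [::] => delta set0 (Psi i w)
  | a :: s' => q ^+ (i == a) *: creat q a (hword s' i w)
               + (if (i < a)%N then g else 0) *: creat q i (hword s' a w)
  end.

Fact hword_is_linear s i : linear (hword s i).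
Proof.
move=> c v w; elim: s i => [|a s IHs] i /=; first by rewrite !linearP.
rewrite !IHs !linearP /= addrACA.
by congr (_ + _ + _); rewrite !scalerA mulrC.
Qed.
HB.instance Definition _ s i :=
  GRing.isLinear.Build C W (fock n W) *:%R (hword s i) (hword_is_linear s i).

(** Pushing eta_i through a word respects the exterior relations of the xi. By induction only
    relations between the two leading letters need checking, according to the order of [i], [a] and
    [b]; the value [q - q^-1] of [g] makes the terms cancel. *)
Lemma hword_ext i w : ext_seq q (fun s => hword s i w).
Proof.
move=> u s a.
have creatC b (c : 'I_n) (f : fock n W) : (b < c)%N -> creat q c (creat q b f) = - q
  *: creat q b (creat q c f).
  exact: (creat_ext q b f).2.
have creat2 b (f : fock n W) : creat q b (creat q b f) = 0 by exact: (creat_ext q b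
  f).1.
elim: u i => [|c u IHu] i; last first.
  split=> [|b ab] /=; first by rewrite !(IHu _).1 !linear0 addr0.
  rewrite !(IHu _).2 // !creatZ scalerDr !scalerA.
  by congr (_ *: _ + _ *: _); rewrite mulrC.
split=> [|b ab] /=; rewrite -!val_eqE /= ?(ltnn a) ?eqxx.
  case: (ltngtP i a) => [ia|ai|/val_inj->];
    rewrite ?scale0r ?scale1r ?addr0 ?creatD ?creatZ ?creat2 ?scaler0 ?addr0 //.
  rewrite add0r creatC // !scalerA -scalerDl.
  by rewrite mulrN mulrC addNr scale0r.
rewrite (ltn_eqF ab) (gtn_eqF ab) ab (ltnNge b) (ltnW ab) /=.
case: (ltngtP i a) => [ia|ai|/val_inj ia].
- rewrite (ltn_eqF (ltn_trans ia ab)) (ltn_trans ia ab) !creatD !creatZ.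
  rewrite (creatC a b) // (creatC i b) ?(ltn_trans ia) // (creatC i a) //.
  by lmod_eq C; rewrite /=; field.
- case: (ltngtP i b) => [ib|bi|/val_inj->]; rewrite !creatD !creatZ (creatC a b) //.
  + by rewrite (creatC a i) //; lmod_eq C; rewrite /=; field.
  + by lmod_eq C; rewrite /=; field.
  + by lmod_eq C; rewrite /=; field.
- rewrite ia (ltn_eqF ab) ab !creatD !creatZ creat2 (creatC a b) //.
  by lmod_eq C; rewrite /=; field.
Qed.

Definition hop i (f : fock n W) : fock n W :=
  \sum_(K : {set 'I_n}) hword (enum K) i (f K).

Fact hop_is_linear i : linear (hop i).
Proof.
move=> c f h; rewrite /hop scaler_sumr -big_split; apply: eq_bigr => K _ /=.
by rewrite !ffunE linearP.
Qed.
HB.instance Definition _ i :=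
  GRing.isLinear.Build C (fock n W) (fock n W) *:%R (hop i) (hop_is_linear i).

Definition hops i : {linear fock n W -> fock n W} := hop i.

Lemma hop_delta i K w : hop i (delta K w) = hword (enum K) i w.
Proof.
rewrite /hop (bigD1 K) //= big1 ?addr0 => [|J JK]; rewrite ffunE ?eqxx //.
by rewrite (negPf JK) linear0.
Qed.

(** [hop] is defined on increasing words only, but [hword_ext] sorts [a :: enum K], and on that word
    the rule is the recursion of [hword]. *)
Lemma hop_cross : cross hops (@creats C n q W).
Proof.
move=> i a f; rewrite {1}[f]fock_sum (linear_sum (creats q W a)) (linear_sum (hops i)).
rewrite (linear_sum (creats q W a)) (linear_sum (creats q W i)) !scaler_sumr.
rewrite -big_split; apply: eq_bigr => K _; move: (f K) => w.
rewrite /hops /creats /= creat_delta.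
rewrite -[RHS]/(hword (a :: enum K) i w) (ext_seq_cons a K (hword_ext i w)).
by case: ifP => _; rewrite ?linear0 // linearZ /= hop_delta.
Qed.

Lemma hop_ext : ext_ops q Psi -> ext_ops q hops.
Proof.
move=> extPsi.
(* Words instead of sets allow an induction that commutes two eta past one xi at a time; by
   [creat_enum], words applied to vacuum vectors span the space. *)
have bas s w : forall i, hop i (hop i (opseq (@creats C n q W) s (delta set0 w))) = 0 /\
  forall k, (i < k)%N -> hop k (hop i (opseq (@creats C n q W) s (delta set0 w)))
   = - q *: hop i (hop k (opseq (@creats C n q W) s (delta set0 w))).
  elim: s => [|a s IHs] i /=.
    rewrite !hop_delta enum_set0 /= !hop_delta enum_set0 /= (extPsi i w).1 linear0.
    by split=> // k ik; rewrite !hop_delta enum_set0 /= !hop_delta enum_set0 /=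
      (extPsi i w).2 // linearZ.
  set v := opseq _ _ _ in IHs *.
  have X j b (u : fock n W) : hop j (creat q b u) = q ^+ (j == b) *: creat q b (hop j u)
      + (if (j < b)%N then g else 0) *: creat q j (hop b u) by exact: hop_cross.
  have D j : {morph hop j : f h / f + h} by exact: linearD.
  have Z j c (u : fock n W) : hop j (c *: u) = c *: hop j u by exact: linearZ.
  have Z2 j : hop j (hop j v) = 0 by exact: (IHs j).1.
  have Zc j k : (j < k)%N -> hop k (hop j v) = - q *: hop j (hop k v).
    exact: (IHs j).2.
  split=> [|k ik]; rewrite !X !D !Z !X -!val_eqE /= ?ltnn ?eqxx ?(ltn_eqF ik)
    ?(gtn_eqF ik) ?ik ?(leq_gtF (ltnW ik)).
    rewrite Z2; case: (ltngtP i a) => [ia|ai|/val_inj->]; last 1 first.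
    + by rewrite Z2 linear0; lmod_eq C; rewrite /=; ring.
    + by rewrite (Zc i a) // linear0 creatZ; lmod_eq C; rewrite /=; field.
    + by rewrite linear0; lmod_eq C; rewrite /=; field.
  case: (ltngtP k a) => [ka|ak|/val_inj E].
  - rewrite (ltn_eqF (ltn_trans ik ka)) (ltn_trans ik ka) (Zc i k) //
    (Zc i a) ?(ltn_trans ik) //.
    by rewrite (Zc k a) // !creatZ; lmod_eq C; rewrite /=; field.
  - case: (ltngtP i a) => [ia|ai|/val_inj ia]; rewrite (Zc i k) //.
    + by rewrite (Zc a k) // !creatZ; lmod_eq C; rewrite /=; field.
    + by rewrite creatZ; lmod_eq C; rewrite /=; field.
    + by rewrite creatZ; lmod_eq C; rewrite /=; field.
  - move: ik; rewrite E => ik; rewrite ik (ltn_eqF ik) Z2 (Zc i a) // linear0 creatZ.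
    by lmod_eq C; rewrite /=; field.
move=> i f.
have S j k : hop j (hop k f) = \sum_K hop j (hop k (delta K (f K))).
  rewrite -(linear_sum (hops j)); congr (hop _ _).
  by rewrite {1}[f]fock_sum; exact: (linear_sum (hops k)).
split=> [|k ik]; rewrite /hops /= !S.
  rewrite big1 // => K _.
  by rewrite -(creat_enum q); exact: (bas _ _ i).1.
by rewrite scaler_sumr; apply: eq_bigr => K _; rewrite -(creat_enum q);
  exact: (bas _ _ i).2.
Qed.

End Hop.
End Braiding.

(** * Coaction of the quantum matrices *)

Section Coaction.
Context (C : fieldType) (n : nat) (q : C) (q_neq0 : q != 0).
Implicit Types (i j k l a b : 'I_n) (I J K : {set 'I_n}) (s u : seq 'I_n).
Context (A : algType C) (x : 'I_n -> 'I_n -> A).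

Local Notation g := (q - q^-1).

(* The defining relations of quantum matrices, in the form in which they make
   [eta_i |-> sum_j x_ij eta_j, xi_i |-> sum_j x_ij xi_j] preserve [cross]. *)
Definition RTT : Prop := forall i a j b,
  q ^+ (j == b) *: (x i b * x a j)
    + (if (j < b)%N then g else 0) *: (x i j * x a b) =
  q ^+ (i == a) *: (x a j * x i b)
    + (if (i < a)%N then g else 0) *: (x i j * x a b).

Context (xRTT : RTT).

Lemma RTT_row i j l : (j < l)%N -> x i j * x i l = q *: (x i l * x i j).
Proof.
move=> jl; have := xRTT i i l j.
rewrite -!val_eqE /= eqxx ltnn (gtn_eqF jl) (leq_gtF (ltnW jl)).
by rewrite expr1 expr0 !scale0r !addr0 scale1r.
Qed.

Lemma RTT_anti i k j l : (i < k)%N -> (j < l)%N -> x i l * x k j = x k j * x i l.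
Proof.
move=> ik jl; have := xRTT i k j l.
rewrite -!val_eqE /= (ltn_eqF ik) (ltn_eqF jl) jl ik !expr0 !scale1r.
exact: addIr.
Qed.

Lemma RTT_diag i k j l : (i < k)%N -> (j < l)%N ->
  x i j * x k l = x k l * x i j + g *: (x i l * x k j).
Proof.
move=> ik jl; have := xRTT i k l j.
rewrite -!val_eqE /= (ltn_eqF ik) (gtn_eqF jl) ik (leq_gtF (ltnW jl)).
by rewrite !expr0 !scale1r scale0r addr0.
Qed.

Section Act.
Context (U : lmodType C) (act : A -> {linear U -> U}).
Context (actM : forall y z v, act (y * z) v = act y (act z v)).
Context (actL : forall c y z v, act (c *: y + z) v = c *: act y v + act z v).

Lemma actD y z v : act (y + z) v = act y v + act z v.
Proof. by rewrite -[y]scale1r actL !scale1r. Qed.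

Lemma act0 v : act 0 v = 0.
Proof. by apply: (addrI (act 0 v)); rewrite -actD !addr0. Qed.

Lemma actZ c y v : act (c *: y) v = c *: act y v.
Proof. by rewrite -[_ *: y]addr0 actL act0 addr0. Qed.

Definition act_equivariant (T : 'I_n -> {linear U -> U}) : Prop :=
  forall i y v, T i (act y v) = act y (T i v).

Definition coact (T : 'I_n -> {linear U -> U}) i (v : U) : U :=
  \sum_j act (x i j) (T j v).

Fact coact_is_linear T i : linear (coact T i).
Proof.
move=> c v w; rewrite /coact scaler_sumr -big_split; apply: eq_bigr => j _ /=.
by rewrite !linearP.
Qed.
HB.instance Definition _ T i :=
  GRing.isLinear.Build C U U *:%R (coact T i) (coact_is_linear T i).

Definition coacts T i : {linear U -> U} := coact T i.

Lemma coact2 T T' i k v : act_equivariant T ->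
  coact T i (coact T' k v) =
  \sum_j \sum_l act (x i j * x k l) (T j (T' l v)).
Proof.
move=> eqT; apply: eq_bigr => j _; rewrite /coact !linear_sum.
by apply: eq_bigr => l _; rewrite eqT actM.
Qed.

(** Each term is paired with its transpose, so that the quadratic relations apply to one ordered
    pair at a time. *)
Lemma sum_lt_gt (F : 'I_n -> 'I_n -> U) :
  \sum_j \sum_l F j l = \sum_j F j j + \sum_j \sum_(l | (val j < val l)%N) (F j l + F
    l j).
Proof.
have -> : \sum_j \sum_(l | (val j < val l)%N) (F j l + F l j) =
    \sum_j \sum_(l | (val j < val l)%N) F j l + \sum_j \sum_(l | (val l < val j)%N) F
      j l.
  under eq_bigr do rewrite big_split.
  by rewrite big_split /=; congr (_ + _); rewrite (exchange_big_dep predT).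
rewrite -!big_split /=.
apply: eq_bigr => j _; rewrite (bigD1 j) //=; congr (_ + _).
rewrite (bigID (fun l : 'I_n => (j < l)%N)) /=; congr (_ + _); apply: eq_bigl => l.
  by rewrite -val_eqE /=; case: ltngtP.
by rewrite -val_eqE /=; case: ltngtP.
Qed.

(** Squares of the [T j] vanish. Within one row, the factor [- q] from exchanging two operators
    cancels the factor [q] from exchanging two entries; for two rows the diagonal and antidiagonal
    relations do the work. *)
Lemma coact_ext T : act_equivariant T -> ext_ops q T -> ext_ops q (coacts T).
Proof.
move=> eqT extT i v; split=> [|k ik]; rewrite /coacts /= !coact2 // !sum_lt_gt.
  rewrite !big1 ?addr0 // => j _; last by rewrite (extT _ _).1 linear0.
  rewrite big1 // => l jl; rewrite (extT j v).2 // RTT_row // actZ linearZ /=.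
  by lmod_eq C; ring.
rewrite scalerDr !scaler_sumr; congr (_ + _); apply: eq_bigr => j _.
  by rewrite (extT _ _).1 !linear0.
rewrite scaler_sumr; apply: eq_bigr => l jl; rewrite (extT j v).2 // !linearZ /=.
rewrite (RTT_diag ik jl) (RTT_anti ik jl) actD actZ.
by lmod_eq C; rewrite /=; field.
Qed.

(** Once every E has crossed every X, comparing the coefficients of [X j (E b v)] is exactly
    [RTT]. *)
Lemma coact_cross E X : act_equivariant E -> act_equivariant X ->
  cross q E X -> cross q (coacts E) (coacts X).
Proof.
move=> eqE eqX EX i a v; rewrite /coacts /= !coact2 // !scaler_sumr.
rewrite -big_split /=.
under eq_bigr do under eq_bigr do rewrite EX linearD !linearZ /=.
under eq_bigr do rewrite big_split.
rewrite big_split /= [X in X + _]exchange_big -big_split; apply: eq_bigr => j _ /=.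
rewrite !scaler_sumr -!big_split; apply: eq_bigr => b _ /=.
by rewrite -!actZ -!actD eq_sym xRTT.
Qed.

End Act.
End Coaction.

(** * Universal property of the Fock spaces and straightening *)

Section Fold.
Context (C : fieldType) (n : nat) (q : C) (q_neq0 : q != 0).
Implicit Types (i j k l a b : 'I_n) (I J K : {set 'I_n}) (s u : seq 'I_n).

(** The extension of [phi] to the exterior module induced from [W]. *)
Definition fold (W U : lmodType C) (T : 'I_n -> {linear U -> U})
    (phi : {linear W -> U}) (f : fock n W) : U :=
  \sum_(K : {set 'I_n}) opseq T (enum K) (phi (f K)).

Fact fold_is_linear (W U : lmodType C) (T : 'I_n -> {linear U -> U})
    (phi : {linear W -> U}) : linear (fold T phi).
Proof.
move=> c f h; rewrite /fold scaler_sumr -big_split; apply: eq_bigr => K _ /=.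
by rewrite !ffunE !linearP.
Qed.
HB.instance Definition _ (W U : lmodType C) (T : 'I_n -> {linear U -> U})
    (phi : {linear W -> U}) :=
  GRing.isLinear.Build C (fock n W) U *:%R (fold T phi) (fold_is_linear T phi).

Lemma fold_delta (W U : lmodType C) T (phi : {linear W -> U}) K w :
  fold T phi (delta K w) = opseq T (enum K) (phi w).
Proof.
rewrite /fold (bigD1 K) //= big1 ?addr0 => [|J JK]; rewrite ffunE ?eqxx //.
by rewrite (negPf JK) !linear0.
Qed.

Lemma fock_eq (W U : lmodType C) (F G : {linear fock n W -> U}) :
  (forall K w, F (delta K w) = G (delta K w)) -> F =1 G.
Proof.
move=> FG f; rewrite [f]fock_sum !linear_sum; apply: eq_bigr => K _; exact: FG.
Qed.

Lemma fold_creat (W U : lmodType C) T (phi : {linear W -> U}) a f :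
  ext_ops q T -> fold T phi (creat q a f) = T a (fold T phi f).
Proof.
move=> extT; move: f.
apply: (@fock_eq W U (fold T phi \o creats q W a) (T a \o fold T phi)) => K w /=.
rewrite /creats /= creat_delta fold_delta (ext_ops_cons _ _ _ extT).
by case: ifP => _; rewrite ?linear0 // linearZ /= fold_delta.
Qed.

Lemma fold_creats (W U : lmodType C) T (phi : {linear W -> U}) s f :
  ext_ops q T -> fold T phi (opseq (creats q W) s f) = opseq T s (fold T phi f).
Proof. by move=> extT; elim: s => //= a s <-; rewrite fold_creat. Qed.

(** [hword] and the operators [E], [X] push eta_i through a word by the same rule, and [phi] matches
    the actions at its end. *)
Lemma fold_hop (W U : lmodType C) (Psi : 'I_n -> {linear W -> W})
    (X E : 'I_n -> {linear U -> U}) (phi : {linear W -> U}) i f :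
    ext_ops q X -> cross q E X -> (forall j w, phi (Psi j w) = E j (phi w)) ->
  fold X phi (hop q Psi i f) = E i (fold X phi f).
Proof.
move=> extX EX phiE; move: f.
apply: (@fock_eq W U (fold X phi \o hops q Psi i) (E i \o fold X phi)) => K w /=.
rewrite /hops /= hop_delta fold_delta.
elim: (enum K) i => [|a s IHs] i /=; first by rewrite fold_delta enum_set0 /= phiE.
by rewrite EX linearD !linearZ /= !fold_creat // !IHs.
Qed.

Definition scalev (U : lmodType C) (v : U) (c : C^o) : U := c *: v.
Fact scalev_is_linear (U : lmodType C) (v : U) : linear (scalev v).
Proof. by move=> c y z; rewrite /scalev scalerDl scalerA. Qed.
HB.instance Definition _ (U : lmodType C) (v : U) :=
  GRing.isLinear.Build C C^o U *:%R (scalev v) (scalev_is_linear v).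

(** The braided tensor square with coefficients in [W]: the outer index belongs to the xi, the inner
    one to the eta. *)
Definition fock2 (W : lmodType C) : lmodType C := fock n (fock n W).
Definition xis (W : lmodType C) i : {linear fock2 W -> fock2 W} := creats q (fock n
  W) i.
Definition etas (W : lmodType C) i : {linear fock2 W -> fock2 W} := hops q (creats q
  W) i.
Definition vac2 (W : lmodType C) (w : W) : fock2 W := delta set0 (delta set0 w).

(* The coefficient of [xi_K eta_J] in [eta_s xi_u]. *)
Definition brd s u : fock2 C^o := opseq (etas C^o) s (opseq (xis C^o) u (vac2 (1 :
  C^o))).

(** [fock2 C^o] is universal for such [X], [E] and [v]: the map sending its vacuum to [v]
    intertwines the operators, so the coefficients [brd] serve every [U]. *)
Lemma straighten (U : lmodType C) (X E : 'I_n -> {linear U -> U}) v s u :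
    ext_ops q X -> ext_ops q E -> cross q E X ->
  opseq E s (opseq X u v) =
  \sum_K \sum_J brd s u K J *: opseq X (enum K) (opseq E (enum J) v).
Proof.
move=> extX extE EX; pose phi := fold E (scalev v).
have fE f : fold X phi f = \sum_K \sum_J f K J *: opseq X (enum K) (opseq E (enum J) v).
  apply: eq_bigr => K _; rewrite /phi /fold linear_sum; apply: eq_bigr => J _.
  by rewrite /= /scalev !linearZ.
rewrite -fE /brd.
have ev : fold X phi (vac2 (1 : C^o)) = v.
  by rewrite fold_delta enum_set0 /= /phi fold_delta enum_set0 /= /scalev scale1r.
rewrite -[in LHS]ev -(fold_creats _ u _ extX) {ev}; elim: s => [|a s IHs] /=;
  first exact: erefl.
rewrite IHs -(@fold_hop _ _ (creats q C^o) X) // => j w.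
exact: fold_creat.
Qed.

Lemma xi_eta_vac (W : lmodType C) K J (w : W) :
  opseq (xis W) (enum K) (opseq (etas W) (enum J) (vac2 w)) = delta K (delta J w).
Proof.
have -> s : opseq (etas W) s (vac2 w) = delta set0 (opseq (creats q W) s (delta set0
  w)).
  by elim: s => //= a s ->; rewrite /etas /hops /= hop_delta enum_set0.
by rewrite creat_enum /xis creat_enum.
Qed.

End Fold.

(** * Maps acting on coefficients *)

Section FockMap.
Context (C : fieldType) (n : nat) (q : C) (q_neq0 : q != 0) (W : lmodType C).
Implicit Types (i j k l a b : 'I_n) (I J K : {set 'I_n}) (s u : seq 'I_n).

Definition fockmap (h : {linear W -> W}) (f : fock n W) : fock n W :=
  [ffun J : {set 'I_n} => h (f J)].

Fact fockmap_is_linear h : linear (fockmap h).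
Proof. by move=> c f f'; apply/ffunP => J; rewrite !ffunE linearP. Qed.
HB.instance Definition _ h :=
  GRing.isLinear.Build C (fock n W) (fock n W) *:%R (fockmap h) (fockmap_is_linear h).

Lemma fockmap_delta h K w : fockmap h (delta K w) = delta K (h w).
Proof. by apply/ffunP => J; rewrite !ffunE; case: eqP; rewrite ?linear0. Qed.

Lemma creat_fockmap h a f : creat q a (fockmap h f) = fockmap h (creat q a f).
Proof.
by apply/ffunP => J; rewrite !ffunE; case: ifP; rewrite ?linear0 ?linearZ.
Qed.

Lemma hop_fockmap (Psi : 'I_n -> {linear W -> W}) (h : {linear W -> W}) i f :
    (forall j w, Psi j (h w) = h (Psi j w)) ->
  hop q Psi i (fockmap h f) = fockmap h (hop q Psi i f).
Proof.
move=> Psih; move: f.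
apply: (@fock_eq C n W _ (hops q Psi i \o fockmap h) (fockmap h \o hops q Psi i)) =>
  K w /=.
rewrite /hops /= fockmap_delta !hop_delta.
elim: (enum K) i => [|a s IHs] i /=; first by rewrite fockmap_delta Psih.
by rewrite linearD !linearZ /= !IHs !creat_fockmap.
Qed.

End FockMap.

(** * Quantum minors *)

Section Minors.
Context (C : fieldType) (n : nat) (q : C) (q_neq0 : q != 0).
Implicit Types (i j k l a b : 'I_n) (I J K : {set 'I_n}) (s u : seq 'I_n).
Context (A : algType C) (x : 'I_n -> 'I_n -> A) (xRTT : RTT q x).

Definition mull (y z : A) : A := y * z.
Fact mull_is_linear y : linear (mull y).
Proof. by move=> c v w; rewrite /mull mulrDr scalerAr. Qed.
HB.instance Definition _ y :=
  GRing.isLinear.Build C A A *:%R (mull y) (mull_is_linear y).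

Lemma mullE y z : mull y z = y * z. Proof. by []. Qed.

Definition act1 y : {linear fock n A -> fock n A} := fockmap (mull y).
Definition act2 y : {linear fock2 n A -> fock2 n A} := fockmap (act1 y).

Lemma act1E y f J : act1 y f J = y * f J.
Proof. by rewrite /act1 /= ffunE. Qed.
Lemma act2E y (f : fock2 n A) K J : act2 y f K J = y * f K J.
Proof. by rewrite /act2 /= ffunE act1E. Qed.

Lemma act1M y z v : act1 (y * z) v = act1 y (act1 z v).
Proof. by apply/ffunP => J; rewrite /act1 /= !ffunE /= !mullE mulrA. Qed.
Lemma act1L c y z v : act1 (c *: y + z) v = c *: act1 y v + act1 z v.
Proof. by apply/ffunP => J; rewrite /act1 /= !ffunE /= !mullE mulrDl scalerAl. Qed.
Lemma act2M y z v : act2 (y * z) v = act2 y (act2 z v).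
Proof. by apply/ffunP => J; rewrite /act2 /= !ffunE /= act1M. Qed.
Lemma act2L c y z v : act2 (c *: y + z) v = c *: act2 y v + act2 z v.
Proof. by apply/ffunP => J; rewrite /act2 /= !ffunE /= act1L. Qed.

Lemma act1_creats : act_equivariant act1 (creats q A).
Proof. move=> i y v; exact: creat_fockmap. Qed.
Lemma act2_xis : act_equivariant act2 (xis q A).
Proof. move=> i y v; exact: creat_fockmap. Qed.
Lemma act2_etas : act_equivariant act2 (etas q A).
Proof. move=> i y v; apply: hop_fockmap => j w; exact: creat_fockmap. Qed.

(* The quantum minor with rows [s] (in this order, possibly repeated) and
   columns [J]. *)
Definition qminor s J : A :=
  (opseq (coacts x act1 (creats q A)) s (delta set0 1) : fock n A) J.

Lemma qminor_nil J : qminor [::] J = (J == set0)%:R.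
Proof. by rewrite /qminor /= ffunE; case: eqP. Qed.

(** Laplace expansion along the first row; [creat q j] supplies the power of [- q]. *)
Lemma qminor_cons i s J :
  qminor (i :: s) J = \sum_(j in J) (- q) ^+ below j J *: (x i j * qminor s (J :\ j)).
Proof.
rewrite /qminor; set w := opseq _ s _.
rewrite -[opseq _ _ _]/(\sum_j fockmap (mull (x i j)) (creat q j w)).
rewrite sum_ffunE [RHS]big_mkcond; apply: eq_bigr => j _ /=.
by rewrite !ffunE /= mullE; case: ifP; rewrite ?mulr0 // scalerAr.
Qed.

Lemma qminor_size s J : size s != #|J| -> qminor s J = 0.
Proof.
elim: s J => [|i s IHs] J sJ; first by rewrite qminor_nil -cards_eq0 eq_sym (negPf sJ).
rewrite qminor_cons big1 // => j jJ; rewrite IHs ?mulr0 ?scaler0 //.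
by apply: contra sJ => /eqP /= ->; rewrite (cardsD1 j J) jJ.
Qed.

Lemma qminor_ext J : ext_seq q (fun s => qminor s J).
Proof.
have := ext_ops_seq (delta set0 1) (coact_ext q_neq0 xRTT act1M act1L act1_creats
  (@creat_ext C n q A)).
move=> H u s a; split=> [|b ab]; rewrite /qminor.
  by rewrite (H u s a).1 ffunE.
by rewrite (H u s a).2 // ffunE.
Qed.

Section Expand.
Context (U : lmodType C) (act : A -> {linear U -> U}).
Context (actM : forall y z v, act (y * z) v = act y (act z v)).
Context (actL : forall c y z v, act (c *: y + z) v = c *: act y v + act z v).
Context (act1r : forall v, act 1 v = v).

Let actv v y := act y v.
Let actv_is_linear v : linear (actv v). Proof. by move=> c y z; apply: actL. Qed.
HB.instance Definition _ v := GRing.isLinear.Build C A U *:%R (actv v)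
  (actv_is_linear v).

Lemma opseq_act T s y v : act_equivariant act T -> opseq T s (act y v) = act y (opseq
  T s v).
Proof. by move=> eqT; elim: s => //= a s ->; rewrite eqT. Qed.

(** Quantum minors are the matrix coefficients of the exterior coaction. They are defined in
    [fock n A], and folding along [y |-> act y v] carries the expansion over to [U]. *)
Lemma coact_opseq T s v : act_equivariant act T -> ext_ops q T ->
  opseq (coacts x act T) s v = \sum_J act (qminor s J) (opseq T (enum J) v).
Proof.
move=> eqT extT; transitivity (fold T (actv v) (opseq (coacts x act1 (creats q A)) s
  (delta set0 1))).
  elim: s => [|i s IHs] /=.
    by rewrite fold_delta enum_set0 /= /actv act1r.
  rewrite {1}IHs /coacts /coact /= linear_sum; apply: eq_bigr => j _.
  rewrite -(fold_creat _ _ _ extT); apply/esym; rewrite /fold linear_sum;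
    apply: eq_bigr => K _.
  by rewrite !ffunE /= mullE /actv actM opseq_act.
by apply: eq_bigr => J _; rewrite /= /actv opseq_act.
Qed.
End Expand.
End Minors.

(** * Exchange relation between quantum minors *)

Section Braid.
Context (C : fieldType) (n : nat) (q : C) (q_neq0 : q != 0).
Implicit Types (i j k l a b : 'I_n) (I J K : {set 'I_n}) (s u : seq 'I_n).

Local Notation g := (q - q^-1).

Section Exchange.
Context (A : algType C) (x : 'I_n -> 'I_n -> A) (xRTT : RTT q x).

Let v0 : fock2 n A := vac2 n (1 : A).
Let X := @xis C n q A.
Let E := @etas C n q A.
Let X' := coacts x (@act2 C n A) X.
Let E' := coacts x (@act2 C n A) E.
Let D := qminor q x.

Let extX : ext_ops q X. Proof. exact: creat_ext. Qed.
Let extE : ext_ops q E. Proof. by apply: hop_ext => //; exact: creat_ext. Qed.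
Let EX : cross q E X. Proof. exact: hop_cross. Qed.
Let act21 v : act2 n (1 : A) v = v.
Proof. by apply/ffunP => K; apply/ffunP => J; rewrite act2E mul1r. Qed.

Let expE s v := coact_opseq x (@act2M C n A) (@act2L C n A) act21 s v (@act2_etas C n
  q A) extE.
Let expX s v := coact_opseq x (@act2M C n A) (@act2L C n A) act21 s v (@act2_xis C n
  q A) extX.

Let coact_EX s u : opseq E' s (opseq X' u v0) =
  \sum_I \sum_K act2 n (D s I * D u K) (opseq E (enum I) (opseq X (enum K) v0)).
Proof.
rewrite expE; apply: eq_bigr => I _; rewrite expX !linear_sum.
apply: eq_bigr => K _; rewrite /= (opseq_act _ _ _ (@act2_etas C n q A)).
by rewrite act2M.
Qed.

Let coact_XE s u : opseq X' s (opseq E' u v0) =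
  \sum_K \sum_J act2 n (D s K * D u J) (opseq X (enum K) (opseq E (enum J) v0)).
Proof.
rewrite expX; apply: eq_bigr => I _; rewrite expE !linear_sum.
apply: eq_bigr => K _; rewrite /= (opseq_act _ _ _ (@act2_xis C n q A)).
by rewrite act2M.
Qed.

Let sumE (T : finType) (F : T -> fock2 n A) K J : (\sum_t F t) K J = \sum_t F t K J.
Proof. by rewrite !sum_ffunE. Qed.

Let scaleE (c : C) (f : fock2 n A) K J : (c *: f) K J = c *: f K J.
Proof. by rewrite !ffunE. Qed.

Let sum2_delta (F : {set 'I_n} -> {set 'I_n} -> A) K J :
  \sum_K' \sum_J' F K' J' * (delta K' (delta J' 1 : fock n A) : fock2 n A) K J = F K J.
Proof.
rewrite (bigD1 K) //= (bigD1 J) //= !ffunE eqxx !ffunE eqxx mulr1.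
rewrite !big1 ?addr0 // => [K' K'K | J' J'J].
  by rewrite big1 // => J' _; rewrite !ffunE eq_sym (negPf K'K) ffunE mulr0.
by rewrite !ffunE eqxx !ffunE eq_sym (negPf J'J) mulr0.
Qed.

(** Both sides are the coefficient of xi_K0 eta_J0 in the vector [G]: straighten the coacted
    operators and then expand into minors, or expand first and then straighten. *)
Lemma brd_exchange I K (K0 J0 : {set 'I_n}) :
  \sum_(K' : {set 'I_n}) \sum_(J' : {set 'I_n}) brd q (enum I) (enum K) K' J' *: (D
    (enum K') K0 * D (enum J') J0) =
  \sum_(I' : {set 'I_n}) \sum_(K' : {set 'I_n}) brd q (enum I') (enum K') K0 J0 *: (D
    (enum I) I' * D (enum K) K').
Proof.
pose G := opseq E' (enum I) (opseq X' (enum K) v0).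
have extX' : ext_ops q X'.
  by apply: coact_ext => //; [exact: act2M|exact: act2L|exact: act2_xis].
have extE' : ext_ops q E'.
  by apply: coact_ext => //; [exact: act2M|exact: act2L|exact: act2_etas].
have EX' : cross q E' X'.
  by apply: coact_cross => //;
    [exact: act2M|exact: act2L|exact: act2_etas|exact: act2_xis].
transitivity (G K0 J0).
  rewrite /G (straighten _ _ _ extX' extE' EX').
  rewrite sumE; apply: eq_bigr => K' _; rewrite sumE; apply: eq_bigr => J' _.
  rewrite scaleE; congr (_ *: _); rewrite coact_XE sumE.
  under [RHS]eq_bigr do rewrite sumE.
  under [RHS]eq_bigr do under eq_bigr do rewrite xi_eta_vac act2E.
  by rewrite sum2_delta.
rewrite /G coact_EX sumE; apply: eq_bigr => I' _; rewrite sumE; apply: eq_bigr => K' _.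
rewrite act2E -[in RHS]mulr_algr; congr (_ * _).
rewrite (straighten _ _ _ extX extE EX) sumE.
under eq_bigr do rewrite sumE.
under eq_bigr do under eq_bigr do rewrite xi_eta_vac scaleE -mulr_algl.
by rewrite sum2_delta.
Qed.
End Exchange.
End Braid.

(** * Sums of principal minors commute *)

(* The last hypothesis reads [p be = al p], and [p] is invertible on [P]; only
   the entries of [p] are central. *)
Lemma trace_triangular_conj (C : fieldType) (A : algType C) (T : finType)
    (P : pred T) (w : T -> nat) (p : T -> T -> C) (al be : T -> T -> A) :
  (forall t, p t t != 0) ->
  (forall t u, t != u -> (w u <= w t)%N -> p t u = 0) ->
  (forall t u, P t -> P u ->
    \sum_(v | P v) p t v *: be v u = \sum_(v | P v) p v u *: al t v) ->
  \sum_(t | P t) al t t = \sum_(t | P t) be t t.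
Proof.
move=> pd pt pab.
(* Padding by the identity outside [P] gives a square matrix indexed by all of [T]. *)
pose M := \matrix_(i < #|T|, j < #|T|)
  (let t := enum_val i in let u := enum_val j in
   if P t && P u then p t u else (t == u)%:R) : 'M[C]_#|T|.
have Mu : M \in unitmx.
  (* If [v] is a nonzero vector of the left kernel, take [i] of least weight in its support:
     triangularity leaves only the diagonal term in entry [i] of [v *m M]. *)
  rewrite -row_free_unit; apply/inj_row_free => v vM0.
  apply/rowP => j; rewrite mxE; apply/eqP/negPn/negP => vj.
  case: (@arg_minnP _ j (fun k => v 0 k != 0) (fun k => w (enum_val k)) vj) => i vi
    imin.
  have := congr1 (fun r : 'rV_#|T| => r 0 i) vM0;
    rewrite !mxE (bigD1 i) //= mxE /= eqxx.
  rewrite big1 ?addr0 => [|k ki].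
    by move/eqP; rewrite mulf_eq0 (negPf vi) /=; case: ifP;
      rewrite ?(negPf (pd _)) ?oner_eq0.
  have [->|vk] := eqVneq (v 0 k) 0; first by rewrite mul0r.
  have kiv : enum_val k != enum_val i by rewrite (inj_eq enum_val_inj).
  by rewrite mxE /= (negPf kiv); case: ifP => _; rewrite ?mulr0 // pt ?mulr0 ?imin.
pose r t u := invmx M (enum_rank t) (enum_rank u).
have pM t u : P t -> P u -> p t u = M (enum_rank t) (enum_rank u).
  by move=> Pt Pu; rewrite mxE /= !enum_rankK Pt Pu.
have M0 t u : P t != P u -> M (enum_rank t) (enum_rank u) = 0.
  rewrite mxE /= !enum_rankK; case: (t =P u) => [->|_]; first by rewrite eqxx.
  by case: (P t); case: (P u).
have rp t u : P t -> P u -> \sum_(v | P v) r t v * p v u = (t == u)%:R.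
  move=> Pt Pu; transitivity ((invmx M *m M) (enum_rank t) (enum_rank u)); last first.
    by rewrite mulVmx // mxE (inj_eq enum_rank_inj).
  rewrite mxE (reindex enum_rank) /=; last by apply: onW_bij; exact: enum_rank_bij.
  rewrite big_mkcond; apply: eq_bigr => v _; case: ifP => Pv; first by rewrite pM.
  by rewrite M0 ?mulr0 // Pv Pu.
have pr t u : P t -> P u -> \sum_(v | P v) p t v * r v u = (t == u)%:R.
  move=> Pt Pu; transitivity ((M *m invmx M) (enum_rank t) (enum_rank u)); last first.
    by rewrite mulmxV // mxE (inj_eq enum_rank_inj).
  rewrite mxE (reindex enum_rank) /=; last by apply: onW_bij; exact: enum_rank_bij.
  rewrite big_mkcond; apply: eq_bigr => v _; case: ifP => Pv; first by rewrite pM.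
  by rewrite M0 ?mul0r // Pv Pt.
(* Insert [p r = 1], replace [al p] by [p be], and contract [r p]; since the entries of [p] and [r]
   are scalars, they move freely past those of [al] and [be]. *)
transitivity (\sum_(t | P t) \sum_(u | P u) r u t *: \sum_(v | P v) p v u *: al t v).
  apply: eq_bigr => t Pt; under eq_bigr do rewrite scaler_sumr.
  rewrite exchange_big /= (bigD1 t) //= [X in _ + X]big1 ?addr0 => [|v /andP[Pv vt]].
    under eq_bigr do rewrite scalerA mulrC.
    by rewrite -scaler_suml pr // eqxx scale1r.
  under eq_bigr do rewrite scalerA mulrC.
  by rewrite -scaler_suml pr // (negPf vt) scale0r.
under eq_bigr => t Pt do under eq_bigr => u Pu do rewrite -pab //.
rewrite exchange_big /=.
under eq_bigr do (under eq_bigr do rewrite scaler_sumr; rewrite exchange_big /=).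
apply: eq_bigr => u Pu;
  rewrite (bigD1 u) //= [X in _ + X]big1 ?addr0 => [|v /andP[Pv vu]].
  under eq_bigr do rewrite scalerA.
  by rewrite -scaler_suml rp // eqxx scale1r.
under eq_bigr do rewrite scalerA.
by rewrite -scaler_suml rp // eq_sym (negPf vu) scale0r.
Qed.

(** * Triangularity of the braiding *)

Section Triangular.
Context (C : fieldType) (n : nat) (q : C) (q_neq0 : q != 0).
Implicit Types (i j k l a b : 'I_n) (I J K : {set 'I_n}) (s u : seq 'I_n).

(* Moving [eta_i] past [xi_K] only adds terms with some [eta_b], [b > i]: the
   off-diagonal coefficients of the braiding increase the weight. *)
Definition weight J : nat := \sum_(j in J) j.
Definition sweight s : nat := \sum_(j <- s) j.

(** A decreasing filtration by weight; in [fil2] only the inner index, that of the eta, is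
    weighed. *)
Definition fil (m : nat) (w : fock n C^o) : Prop := forall J, (weight J < m)%N -> w J
  = 0.
Definition fil2 (m : nat) (f : fock2 n C^o) : Prop := forall K, fil m (f K).

Lemma fil_le m m' w : (m <= m')%N -> fil m' w -> fil m w.
Proof. by move=> mm' fw J Jm; apply: fw; exact: leq_trans Jm mm'. Qed.

Lemma fil2_lin m (c : C) f f' : fil2 m f -> fil2 m f' -> fil2 m (c *: f + f').
Proof. by move=> ff ff' K J Jm; rewrite !ffunE ff // ff' // scaler0 addr0. Qed.

Lemma fil2_0 m : fil2 m 0.
Proof. by move=> K J _; rewrite !ffunE. Qed.

Lemma fil2_scale m c f : fil2 m f -> fil2 m (c *: f).
Proof. by move=> ff; rewrite -[_ *: _]addr0; apply: fil2_lin => //; apply: fil2_0. Qed.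

Lemma fil_creat m i w : fil m w -> fil (m + i) (creat q i w).
Proof.
move=> fw J Jm; rewrite ffunE; case: ifP => // iJ; rewrite fw ?scaler0 //.
by move: Jm; rewrite /weight (big_setD1 i) //= addnC ltn_add2r.
Qed.

Lemma fil2_creat m a (f : fock2 n C^o) : fil2 m f -> fil2 m (creat q a f).
Proof.
move=> ff K J Jm; rewrite ffunE; case: ifP => _; last by rewrite ffunE.
by rewrite ffunE ff // scaler0.
Qed.

Lemma fil2_delta m K w : fil m w -> fil2 m (delta K w).
Proof. by move=> fw K' J Jm; rewrite ffunE; case: eqP => _; rewrite ?ffunE ?fw. Qed.

Let hw s i w := hword q (creats q C^o) s i w.

Lemma fil_hword m s i w : fil m w -> fil2 (m + i) (hw s i w).
Proof.
move=> fw; elim: s i => [|a s IHs] i /=; first by apply: fil2_delta; apply: fil_creat.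
apply: fil2_lin; first exact: fil2_creat.
case: ifP => [ia|_]; last by rewrite scale0r; apply: fil2_0.
apply/fil2_scale/fil2_creat => K; apply: (fil_le _ (IHs a K)).
by rewrite leq_add2l ltnW.
Qed.

(** Modulo higher weight, eta_i commutes with xi_s up to one factor [q] per occurrence of [i]: every
    other crossing term replaces [i] by a larger index. *)
Lemma fil_hword_lead m s i w : fil m w ->
  fil2 (m + i).+1 (hw s i w
    - q ^+ count_mem i s *: opseq (xis q C^o) s (delta set0 (creat q i w))).
Proof.
move=> fw; elim: s i => [|a s IHs] i /=.
  by rewrite expr0 scale1r subrr; apply: fil2_0.
set R := opseq _ s _ in IHs *; set G := _ *: creat q i _.
have -> : q ^+ (i == a) *: creat q a (hword q (creats q C^o) s i w) + G
    - q ^+ ((a == i) + count_mem i s) *: creat q a R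
  = q ^+ (i == a) *: creat q a (hw s i w - q ^+ count_mem i s *: R) + G.
  by rewrite -[in RHS]scaleNr creatD creatZ scaleNr scalerBr scalerA -exprD eq_sym
    addrAC.
apply: fil2_lin; first exact/fil2_creat/IHs.
rewrite {}/G; case: ifP => [ia|_]; last by rewrite scale0r; apply: fil2_0.
apply/fil2_scale/fil2_creat => K; apply: (fil_le _ (@fil_hword _ s a _ fw K)).
by rewrite -addnS leq_add2l.
Qed.

Lemma fil_hop m i (f : fock2 n C^o) : fil2 m f -> fil2 (m + i) (etas q C^o i f).
Proof.
move=> ff; rewrite /etas /hops /= /hop; elim/big_rec: _ => [|K f' _ ff'];
  first exact: fil2_0.
by rewrite -[hword _ _ _ _ _]scale1r; apply: fil2_lin => //; apply: fil_hword.
Qed.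

Lemma fil_opseq m s w : fil m w -> fil (m + sweight s) (opseq (creats q C^o) s w).
Proof.
move=> fw; elim: s => [|a s IHs]; rewrite /sweight ?big_nil ?addn0 // big_cons.
by rewrite addnCA addnC; apply: fil_creat.
Qed.

Lemma fil_etas m s K w : fil m w -> exists2 c : C, c != 0 &
  fil2 (m + sweight s).+1 (opseq (etas q C^o) s (delta K w)
     - c *: delta K (opseq (creats q C^o) s w)).
Proof.
move=> fw; elim: s => [|i s [c c0 IHs]].
  by exists 1; rewrite ?oner_eq0 // scale1r subrr; apply: fil2_0.
pose ws := opseq (creats q C^o) s w.
exists (c * q ^+ count_mem i (enum K)); first by rewrite mulf_neq0 // expf_neq0.
(* The new error is the error of eta_i on the leading term plus eta_i applied to the old error; both
   lie strictly above the leading weight. *)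
have -> : opseq (etas q C^o) (i :: s) (delta K w)
    - (c * q ^+ count_mem i (enum K)) *: delta K (opseq (creats q C^o) (i :: s) w)
  = c *: (hw (enum K) i ws - q ^+ count_mem i (enum K) *: delta K (creat q i ws))
    + etas q C^o i (opseq (etas q C^o) s (delta K w) - c *: delta K ws).
  have -> : etas q C^o i (opseq (etas q C^o) s (delta K w) - c *: delta K ws)
      = opseq (etas q C^o) (i :: s) (delta K w) - c *: hw (enum K) i ws.
    rewrite linearB; congr (_ - _); rewrite linearZ; congr (_ *: _); exact: hop_delta.
  by rewrite scalerBr scalerA [RHS]addrC -addrA; congr (_ + _); rewrite addKr.
have fs : fil (m + sweight s) ws by exact: fil_opseq.
rewrite /sweight big_cons -/(sweight s) addnCA addnC.
apply: fil2_lin; last by rewrite -addSn; apply: fil_hop.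
by have := @fil_hword_lead _ (enum K) i _ fs; rewrite creat_enum.
Qed.

Lemma brdP I K : exists2 c : C, c != 0 & forall K' J', (weight J' <= weight I)%N ->
  brd q (enum I) (enum K) K' J' = c * ((K', J') == (K, I))%:R.
Proof.
have f0 : fil 0 (delta set0 1) by [].
have [c c0] := fil_etas (enum I) K f0; rewrite creat_enum add0n /sweight big_enum => H.
exists c => // K' J' J'I; rewrite -ltnS in J'I; have := H K' J' J'I.
rewrite /brd /xis creat_enum !ffunE => /eqP; rewrite subr_eq0 => /eqP->.
by rewrite xpair_eqE; case: eqP => _; rewrite ffunE ?mulr0 ?scaler0 //; case: eqP.
Qed.

Lemma brd_diag I K : brd q (enum I) (enum K) K I != 0.
Proof. by have [c c0 ->] := brdP I K; rewrite // eqxx mulr1. Qed.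

Lemma brd_triangular I K K' J' : (K', J') != (K, I) -> (weight J' <= weight I)%N ->
  brd q (enum I) (enum K) K' J' = 0.
Proof. by move=> /negPf ne le; have [c _ ->] := brdP I K; rewrite // ne mulr0. Qed.

End Triangular.

(** * Taking traces in the exchange relation *)

Section Commute.
Context (C : fieldType) (n : nat) (q : C) (q_neq0 : q != 0).
Context (A : algType C) (x : 'I_n -> 'I_n -> A) (xRTT : RTT q x).

Definition qsigma (k : nat) : A :=
  \sum_(I : {set 'I_n} | #|I| == k) qminor q x (enum I) I.

Lemma qminor_card (I J : {set 'I_n}) : #|I| != #|J| -> qminor q x (enum I) J = 0.
Proof. by move=> IJ; rewrite qminor_size // -cardE. Qed.

Lemma qsigma_comm k m : qsigma k * qsigma m = qsigma m * qsigma k.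
Proof.
pose T := ({set 'I_n} * {set 'I_n})%type;
  pose P (t : T) := (#|t.1| == m) && (#|t.2| == k).
pose D (I J : {set 'I_n}) := qminor q x (enum I) J.
transitivity (\sum_(t | P t) D t.2 t.2 * D t.1 t.1).
  rewrite /qsigma big_distrlr exchange_big /=.
  by rewrite (pair_big (fun I : {set 'I_n} => #|I| == m) (fun I : {set 'I_n} => #|I|
    == k)).
transitivity (\sum_(t | P t) D t.1 t.1 * D t.2 t.2); last first.
  rewrite /qsigma big_distrlr /=.
  by rewrite (pair_big (fun I : {set 'I_n} => #|I| == m) (fun I : {set 'I_n} => #|I|
    == k)).
(* A pair (K, I) stands for eta_I xi_K as a row index of the braiding and for xi_K eta_I as a column
   index. *)
apply: (@trace_triangular_conj C A _ P (fun t => weight t.2)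
  (fun t u => brd q (enum t.2) (enum t.1) u.1 u.2)
  (fun t u => D t.2 u.2 * D t.1 u.1) (fun t u => D t.1 u.1 * D t.2 u.2)).
- by move=> [K I]; apply: brd_diag.
- by move=> [K I] [K' J'] ne le; apply: brd_triangular; rewrite // eq_sym.
move=> [K I] [K0 J0] /andP[/= /eqP Km /eqP Ik] /andP[/= /eqP K0m /eqP J0k].
have := brd_exchange q_neq0 xRTT I K K0 J0.
rewrite [X in _ = X]exchange_big !pair_big /= -!/(D _ _) => E.
(* The exchange relation sums over all pairs; minors with unequal numbers of rows and columns
   vanish, which restricts both sums to [P]. *)
rewrite [LHS](_ : _ = \sum_v brd q (enum I) (enum K) v.1 v.2 *: (D v.1 K0 * D v.2 J0)).
  rewrite E [RHS]big_mkcond /=; apply: eq_bigr => -[K' J'] _; rewrite /P /=;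
    case: ifP => //.
  move/negbT; rewrite negb_and => /orP[] ne.
    by rewrite (@qminor_card K K') ?mulr0 ?scaler0 // Km eq_sym.
  by rewrite (@qminor_card I J') ?mul0r ?scaler0 // Ik eq_sym.
rewrite [LHS]big_mkcond /=; apply: eq_bigr => -[K' J'] _; rewrite /P /=;
  case: ifP => //.
move/negbT; rewrite negb_and => /orP[] ne.
  by rewrite /D (@qminor_card K' K0) ?mul0r ?scaler0 // K0m.
by rewrite /D (@qminor_card J' J0) ?mulr0 ?scaler0 // J0k.
Qed.
End Commute.

(** * Newton identities *)

Section Newton.
Context (C : fieldType) (n : nat) (q : C) (q_neq0 : q != 0).
Context (A : algType C) (x : 'I_n -> 'I_n -> A) (xRTT : RTT q x).
Implicit Types (i j k l a b : 'I_n) (I J K : {set 'I_n}) (s u : seq 'I_n).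

Let D := qminor q x.

(** The normalisation gives [x i j] the coefficient [D (enum I) I] in the expansion along row
    [i]. *)
Definition qhook m i j : A :=
  \sum_(I : {set 'I_n} | (#|I| == m) && (j \notin I))
    (- q) ^- below j I *: D (i :: enum I) (j |: I).

Lemma qhook0 i j : qhook 0 i j = x i j.
Proof.
rewrite /qhook (big_pred1 set0) => [|I].
  rewrite enum_set0 setU0 [D _ _]qminor_cons big_set1 setDv qminor_nil eqxx mulr1.
  have b0 I : I \subset [set j] -> below j I = 0%N.
    move=> /subsetP sI; apply: eq_card0 => b; rewrite !inE.
    by apply/negP => /andP[/sI]; rewrite inE => /eqP->; rewrite ltnn.
  by rewrite !b0 ?sub0set // expr0 invr1 !scale1r.
by rewrite cards_eq0 /=; case: (I =P set0) => [->|_] //; rewrite inE.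
Qed.

Lemma sum_setU1 (V : nmodType) l (P : pred {set 'I_n}) (F : {set 'I_n} -> V) :
  \sum_(I | P I && (l \in I)) F I = \sum_(K | P (l |: K) && (l \notin K)) F (l |: K).
Proof.
rewrite (reindex_onto (fun K => l |: K) (fun I => I :\ l)) /=; last first.
  by move=> I /andP[_ lI]; rewrite setD1K.
apply: eq_bigl => K; rewrite setU11 andbT; congr (_ && _).
apply/eqP/idP => [<-|lK]; first by rewrite setD11.
by rewrite setU1K.
Qed.

Lemma qminor_insert l K J :
  D (l :: enum K) J = if l \in K then 0 else (- q) ^+ below l K *: D (enum (l |: K)) J.
Proof. exact: (ext_seq_cons l K (qminor_ext q_neq0 xRTT J)). Qed.

Lemma Nq_neq0 : - q != 0. Proof. by rewrite oppr_eq0. Qed.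

(** Expand along row [i]. Column [j] yields principal minors, each column [l] other than [j] a
    multiple of [qhook m l j]. *)
Lemma qhookS m i j : qhook m.+1 i j =
  x i j * qsigma q x m.+1 - \sum_(l < n) q ^ theta j l *: (x i l * qhook m l j).
Proof.
pose Om I := D (enum I) I.
pose S l := \sum_(I : {set 'I_n} | ((#|I| == m.+1) && (j \notin I)) && (l \in I))
  ((- q) ^- below j I * (- q) ^+ below l (j |: I)) *: (x i l * D (enum I) ((j |: I)
    :\ l)).
have -> : qhook m.+1 i j =
    \sum_(I : {set 'I_n} | (#|I| == m.+1) && (j \notin I)) x i j * Om I + \sum_l S l.
  rewrite /S (exchange_big_dep (fun I : {set 'I_n} => (#|I| == m.+1) && (j \notin
    I))) /=;
    last by move=> ? ? _ /andP[].
  rewrite -big_split; apply: eq_bigr => I /andP[Im jI] /=.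
  rewrite [D _ _]qminor_cons big_setU1 //= scalerDr scalerA belowU1 //
    mulVf ?expf_neq0 ?Nq_neq0 //.
  rewrite scale1r setU1K // scaler_sumr; congr (_ + _).
  by apply: eq_big => [l|l _]; rewrite ?Im ?jI // scalerA.
have Sj : S j = 0 by rewrite /S big_pred0 // => I; case: (j \in I); rewrite ?andbF.
have Sl l : l != j -> S l = - (q ^ theta j l *: (x i l * qhook m l j)).
  move=> lj; rewrite /S sum_setU1 /qhook mulr_sumr scaler_sumr -sumrN.
  rewrite [RHS](bigID (fun K : {set 'I_n} => l \in K)) /= [X in _ = X + _]big1
    ?add0r; last first.
    by move=> K /andP[_ lK]; rewrite qminor_insert lK scaler0 mulr0 scaler0 oppr0.
  apply: eq_big => [K|K /andP[/andP[_ jK] lK]].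
    rewrite !inE negb_or [j == l]eq_sym (negPf lj) /=; case lK: (l \in K);
      rewrite ?andbF // !andbT.
    by rewrite cardsU1 lK add1n eqSS.
  rewrite qminor_insert (negPf lK).
  have -> : (j |: (l |: K)) :\ l = j |: K.
    by rewrite setUCA setU1K // !inE negb_or lK andbT.
  rewrite setUCA (@belowU1 n l l) // -!scalerAr !scalerA -scaleNr; congr (_ *: _).
  have {}jK : j \notin K by apply: contra jK => jK; rewrite inE jK orbT.
  (* The leftover factor is [- q] for [j < l] and [(- q)^-1] for [l < j], that is, minus
     [q ^ theta j l]. *)
  have [jl|lt_lj|/val_inj E] := ltngtP j l; last by rewrite E eqxx in lj.
    rewrite (belowU1_lt _ jl) // (belowU1 _ (ltnW jl)) exprS /theta ltz_nat jl expr1z.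
    by rewrite mulrCA !mulNr.
  rewrite (belowU1_lt _ lt_lj) //
    (belowU1 _ (ltnW lt_lj)) exprS /theta ltz_nat ltnNge ltnW //=.
  rewrite eqz_nat gtn_eqF // exprN1 invfM invrN !mulNr; congr (- _); by rewrite mulrA.
rewrite (bigD1 j) //= Sj add0r (eq_bigr _ Sl) sumrN [in RHS](bigD1 j) //= opprD addrA.
(* Sets avoiding [j] give the full [qsigma] minus the sets containing [j]; the latter form the
   summand [l = j] of the star product, where [theta] vanishes. *)
congr (_ - _); rewrite /qsigma mulr_sumr [in RHS](bigID (fun I : {set 'I_n} => j \in
  I)) /= addrAC.
rewrite [X in X - _](_ : _ = q ^ theta j j *: (x i j * qhook m j j)) ?subrr ?add0r //.
rewrite sum_setU1 /qhook mulr_sumr scaler_sumr.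
apply: eq_big => [K|K /andP[_ jK]].
  by rewrite cardsU1; case: (j \in K); rewrite ?andbF // !andbT add1n eqSS.
rewrite qminor_insert (negPf jK) scalerA mulVf ?expf_neq0 ?Nq_neq0 // scale1r.
by rewrite /theta Order.POrderTheory.ltxx eqxx expr0z scale1r.
Qed.

(** Sorting row [i] into [I] cancels the normalisation, and each set of size [m.+1] arises once from
    each of its elements. *)
Lemma qhook_trace m : \sum_i qhook m i i = qsigma q x m.+1 *+ m.+1.
Proof.
rewrite /qhook /qsigma.
have -> : \sum_i \sum_(I : {set 'I_n} | (#|I| == m) && (i \notin I))
     (- q) ^- below i I *: D (i :: enum I) (i |: I) =
   \sum_i \sum_(I : {set 'I_n} | (#|I| == m.+1) && (i \in I)) D (enum I) I.
  apply: eq_bigr => i _; rewrite sum_setU1; apply: eq_big => [K|K /andP[_ iK]].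
    by rewrite cardsU1; case: (i \in K); rewrite ?andbF // !andbT add1n eqSS.
  by rewrite qminor_insert (negPf iK) scalerA mulVf ?expf_neq0 ?Nq_neq0 // scale1r.
rewrite (exchange_big_dep (fun I : {set 'I_n} => #|I| == m.+1)) /=;
  last by move=> ? ? _ /andP[].
rewrite -sumrMnl; apply: eq_bigr => I /eqP Im.
by rewrite (eq_bigl (mem I)) => [|i]; rewrite ?sumr_const ?Im // eqxx.
Qed.

End Newton.

(** * Quantum power sums *)

Lemma RTT_of_rel (C : fieldType) (n : nat) (q : C) (q_neq0 : q != 0) (A : algType C)
    (x : 'I_n -> 'I_n -> A) :
  (forall i j k l : 'I_n, x i j * x k l - x k l * x i j =
     (q ^ theta j l - q ^ (- theta i k)) *: (x i l * x k j)) -> RTT q x.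
Proof.
move=> rel i a j b; have /eqP := rel i b a j; rewrite subr_eq => /eqP.
rewrite /theta !ltz_nat !eqz_nat -!val_eqE /=.
case: (ltngtP j b) => [jb|bj|/val_inj jb]; case: (ltngtP i a) => [ia|ai|/val_inj ia];
  rewrite ?opprK ?oppr0 ?expr0z ?expr1z ?exprN1.
- by move=> ->; lmod_eq C; rewrite /=; field.
- by move=> ->; lmod_eq C; rewrite /=; field.
- by rewrite ia => ->; lmod_eq C; rewrite /=; field.
- by move=> ->; lmod_eq C; rewrite /=; field.
- by move=> ->; lmod_eq C; rewrite /=; field.
- by rewrite ia => ->; lmod_eq C; rewrite /=; field.
(* For equal columns the correction term is a multiple of the product on the left, so it is moved
   across before substituting. *)
- rewrite jb => /(congr1 (fun y => y - (1 - q^-1) *: (x i b * x a b))).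
  rewrite /= [in X in _ = X]addrAC subrr add0r => <-; by rewrite -scaleNr; lmod_eq C;
    rewrite /=; field.
- rewrite jb => /(congr1 (fun y => y - (1 - q) *: (x i b * x a b))).
  rewrite /= [in X in _ = X]addrAC subrr add0r => <-; by rewrite -scaleNr; lmod_eq C;
    rewrite /=; field.
- by rewrite jb ia.
Qed.

Section PowerSums.
Context (C : fieldType) (n : nat) (q : C) (q_neq0 : q != 0).
Context (char0 : forall k, k.+1%:R != 0 :> C).
Context (A : algType C) (x : 'I_n -> 'I_n -> A) (xRTT : RTT q x).

Local Notation sg k := (qsigma q x k).

(** Shifted index: these are the entries of the quantum power of exponent [k.+1]. *)
Fixpoint qpow k (i j : 'I_n) : A :=
  match k with
  | 0 => x i j
  | k'.+1 => \sum_(l < n) q ^ theta j l *: (x i l * qpow k' l j)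
  end.

(* Shifted index: [qptrace k] is t_(k+1). *)
Definition qptrace k : A := \sum_i qpow k i i.

Lemma qsigma0 : sg 0 = 1.
Proof.
rewrite /qsigma (big_pred1 set0) => [|I]; last by rewrite cards_eq0.
by rewrite enum_set0 qminor_nil eqxx.
Qed.

Lemma qsigma_gt k : (n < k)%N -> sg k = 0.
Proof.
move=> nk; rewrite /qsigma big_pred0 // => I; apply/negP => /eqP Ik.
by have := max_card (mem I); rewrite card_ord Ik leqNgt nk.
Qed.

(** Iterating [qhookS] works although the star product is not associative: quantum powers are also
    built by multiplying by [x] on the left, and the [qsigma] stay on the right. *)
Lemma qhook_qexpmx m i j : qhook q x m i j =
  \sum_(a < m.+1) (-1) ^+ a *: (qpow a i j * sg (m - a)).
Proof.
elim: m i j => [|m IHm] i j.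
  by rewrite qhook0 big_ord1 expr0 scale1r subnn qsigma0 mulr1.
rewrite (qhookS q_neq0 xRTT).
rewrite big_ord_recl expr0 scale1r subn0; congr (_ + _).
under eq_bigr => l _ do rewrite IHm mulr_sumr scaler_sumr.
rewrite exchange_big -sumrN; apply: eq_bigr => a _ /=.
rewrite /bump /= add1n subSS exprS mulN1r scaleNr mulr_suml scaler_sumr.
congr (- _); apply: eq_bigr => l _.
by rewrite -!scalerAr mulrA -!scalerAl !scalerA mulrC.
Qed.

Lemma qnewton m :
  \sum_(a < m.+1) (-1) ^+ a *: (qptrace a * sg (m - a)) = sg m.+1 *+ m.+1.
Proof.
rewrite -(qhook_trace q_neq0 xRTT).
under [RHS]eq_bigr do rewrite qhook_qexpmx.
rewrite exchange_big; apply: eq_bigr => a _ /=.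
by rewrite /qptrace mulr_suml scaler_sumr.
Qed.

(** Newton's identity solved for its last summand, where [sg 0] is 1. *)
Lemma qptrace_rec m : qptrace m = (-1) ^+ m *: (sg m.+1 *+ m.+1
  - \sum_(a < m) (-1) ^+ a *: (qptrace a * sg (m - a))).
Proof.
rewrite -qnewton big_ord_recr /= subnn qsigma0 mulr1 addrAC subrr add0r.
by rewrite scalerA -exprMn mulN1r opprK expr1n scale1r.
Qed.

(** By [qptrace_rec] the traces lie in the subalgebra generated by the [qsigma]. *)
Lemma comm_qptrace y : (forall k, GRing.comm y (sg k)) -> forall k, GRing.comm y
  (qptrace k).
Proof.
have commZ c z : GRing.comm y z -> GRing.comm y (c *: z).
  by rewrite /GRing.comm -scalerAr -scalerAl => ->.
move=> ys k; elim/ltn_ind: k => k IHk; rewrite qptrace_rec; apply: (commZ _ _).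
apply: commrB; first exact: commrMn.
elim/big_ind: _ => [|u v|a _]; [exact: commr0|exact: commrD|].
by apply: (commZ _ _); apply: commrM => //; apply: IHk.
Qed.

Lemma qptrace_comm k m : GRing.comm (qptrace k) (qptrace m).
Proof.
apply: comm_qptrace => j; apply/commr_sym; apply: comm_qptrace => l.
exact: (qsigma_comm q_neq0 xRTT).
Qed.

Definition in_qtraces (y : A) : Prop := exists p : mpoly.mpoly n C,
  y = mpoly.mmap (in_alg (A)) (fun i : 'I_n => qptrace i) p.

Lemma in_qtracesD y z : in_qtraces y -> in_qtraces z -> in_qtraces (y + z).
Proof. by move=> [p ->] [p' ->]; exists (p + p'); rewrite mpoly.mmapD. Qed.

Lemma in_qtracesZ c y : in_qtraces y -> in_qtraces (c *: y).
Proof. by move=> [p ->]; exists (c *: p); rewrite mpoly.mmapZ /= mulr_algl. Qed.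

Lemma in_qtraces0 : in_qtraces 0.
Proof. by exists 0; rewrite mpoly.mmap0. Qed.

Lemma in_qtraces_sum (T : Type) (r : seq T) (F : T -> A) :
  (forall i, in_qtraces (F i)) -> in_qtraces (\sum_(i <- r) F i).
Proof. by move=> inF; elim/big_ind: _ => //;
  [exact: in_qtraces0|exact: in_qtracesD]. Qed.

Lemma in_qtraces1 : in_qtraces 1.
Proof. by exists (mpoly.mpolyX C mpoly.mnm0); rewrite mpoly.mmapX mpoly.mmap11. Qed.

Lemma in_qtraces_gen k : (k < n)%N -> in_qtraces (qptrace k).
Proof.
move=> kn; exists (mpoly.mpolyX C (mpoly.mnm1 (Ordinal kn))).
by rewrite mpoly.mmapX mpoly.mmap1U.
Qed.

(** [mmap] evaluates monomials as ordered products in a noncommutative algebra; merging two of them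
    relies on [qptrace_comm]. *)
Lemma in_qtracesM y z : in_qtraces y -> in_qtraces z -> in_qtraces (y * z).
Proof.
move=> [p ->] [p' ->]; rewrite /mpoly.mmap big_distrlr /=.
apply: in_qtraces_sum => m; apply: in_qtraces_sum => m'.
rewrite !mulr_algl -scalerAl -scalerAr; apply/in_qtracesZ/in_qtracesZ.
exists (mpoly.mpolyX C (mpoly.mnm_add m m')); rewrite mpoly.mmapX /mpoly.mmap1.
rewrite -prodrM_comm => [|i j _ _]; last by apply: commrX;
  apply/commr_sym/commrX/qptrace_comm.
by apply: eq_bigr => i _; rewrite mpoly.mnmDE exprD.
Qed.

(** Up to index [n], Newton's identity is divided by [k.+1], using [char0]; beyond [n] there are no
    minors. *)
Lemma in_qtraces_sigma k : in_qtraces (sg k).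
Proof.
elim/ltn_ind: k => -[|k] IHk; first by rewrite qsigma0; exact: in_qtraces1.
have [kn|nk] := ltnP k n; last by rewrite qsigma_gt //; exact: in_qtraces0.
have -> : sg k.+1 = k.+1%:R^-1 *: (sg k.+1 *+ k.+1).
  by rewrite -scaler_nat scalerA mulVf ?scale1r.
rewrite -qnewton; apply/in_qtracesZ/in_qtraces_sum => a; apply/in_qtracesZ/in_qtracesM.
  by apply: in_qtraces_gen; apply: leq_trans (ltn_ord a) kn.
by apply: IHk; rewrite ltnS leq_subr.
Qed.

Lemma in_qtraces_qptrace k : in_qtraces (qptrace k).
Proof.
elim/ltn_ind: k => k IHk; rewrite qptrace_rec; apply: in_qtracesZ; apply: in_qtracesD.
  by rewrite -scaler_nat; apply/in_qtracesZ/in_qtraces_sigma.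
rewrite -scaleN1r; apply/in_qtracesZ/in_qtraces_sum => a.
by apply/in_qtracesZ/in_qtracesM; [exact: IHk | exact: in_qtraces_sigma].
Qed.

Lemma qptrace_poly (t : nat -> A) k : (forall m, t m.+1 = qptrace m) ->
  exists p : mpoly.mpoly n C,
    t k.+1 = mpoly.mmap (in_alg A) (fun i : 'I_n => t i.+1) p.
Proof.
move=> tE; have [p pE] := in_qtraces_qptrace k; exists p.
rewrite tE pE /mpoly.mmap; apply: eq_bigr => m _; congr (_ * _).
by apply: eq_bigr => i _; rewrite tE.
Qed.

End PowerSums.

Lemma qgen_RTT (C : fieldType) (n : nat) (q : C) : q != 0 -> RTT q (qgen n q).
Proof. by move=> q_neq0; apply: RTT_of_rel => // i j k l; exact: qgen_rel. Qed.

Lemma qtrace_qptrace (C : fieldType) (n : nat) (q : C) k :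
  qtrace n q k.+1 = qptrace q (qgen n q) k.
Proof.
(* The recursion leaves the diagonal, so row and column are generalised separately. *)
apply: eq_bigr => i _; elim: k i {2 4}i => [|k IHk] i j //.
rewrite [LHS]mxE; apply: eq_bigr => l _; congr (_ *: (_ * _)); exact: IHk.
Qed.

Theorem theorem4 (R : realType) (n : nat) (q : R[i]) (n_gt0 : (0 < n)%N)
    (q_neq0 : q != 0) :
  let t (k : nat) : qmat n q := qtrace n q k in
  (forall k m : nat, (0 < k)%N -> (0 < m)%N -> t k * t m - t m * t k = 0) /\
  (forall k : nat, (n < k)%N ->
     exists p : mpoly.mpoly n R[i],
       t k = mpoly.mmap (in_alg (qmat n q)) (fun i : 'I_n => t i.+1) p).
Proof.
have RTTq := @qgen_RTT _ n q q_neq0.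
have char0 k : k.+1%:R != 0 :> R[i] by rewrite Num.Theory.pnatr_eq0.
split=> [[|k] [|m] // _ _ | [|k] // _].
  by apply/eqP; rewrite subr_eq0 !qtrace_qptrace; apply/eqP/qptrace_comm.
exact: (@qptrace_poly _ n q q_neq0 char0 (qmat n q) (qgen n q) RTTq
  (qtrace n q) k (qtrace_qptrace n q)).
Qed.
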